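(* Let $p=p_n$ depend on $n$ and suppose that the following hold. (A-1) There exists $S<\infty$ such that $S_p\le S$ for all $p$. (A-2) There exists $m>0$ such that $p^m\omega_p$ is bounded, that is, $\omega_p\le H/p^m$ for some $H<\infty$. (A-3) For a given $t\in[0,1]$ there exists $b_t$ such that $p^{-b_t}\alpha_{n,p}(t)$ is bounded for all $n$ and $p$. (A-4) There exists $c$ such that $p^{-c}\sup_t\alpha_{n,p}(t)$ is bounded for all $n$ and $p$. (A-6) $\delta^{V_{n,p_n}}_{2S}+\theta^{V_{n,p_n}}_{S,2S}$ is bounded away from one (from below one) for large enough $n$, where $n\to\infty$, $p_n\to\infty$ and $p_n/n\to0$. Suppose also that (for $p=p_n$) $\varepsilon_1^*,\dots,\varepsilon_n^*$ are independent with $\varepsilon_i^*\sim N(0,\sigma_2^2)$. Let $\widehat\beta_n$ be the FLiRTI estimate based on $n$ observations, computed (with the Dantzig selector or the lasso) with $p=p_n$ and $\lambda=\sigma_2\sqrt{2(1+\phi)\log p}$, where $\phi\ge0$ is fixed. Suppose that $\boldsymbol\gamma_p=A\boldsymbol\eta_p$ has at most $S_p$ non-zero components, $\delta^{V_{n,p}}_{2S_p}+\theta^{V_{n,p}}_{S_p,2S_p}<1$, and, if the lasso is used, $\mathbf{u}=(D_\lambda\tilde V^T\tilde VD_\lambda)^{-1}\mathbf{1}\ge\mathbf{0}$ and $\|\tilde V^T\tilde VD_\lambda\mathbf{u}\|_\infty\le1$ (with $V=V_{n,p}$, $p=p_n$). Then, if $p_n$ grows at the rate of $n^{1/(2m+2b_t)}$,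 $$|\widehat\beta_n(t)-\beta(t)|=O\left(\frac{\sqrt{\log n}}{n^{\frac12\cdot\frac{m}{m+b_t}}}\right),$$ and, if $p_n$ grows at the rate of $n^{1/(2m+2c)}$, $$\sup_t|\widehat\beta_n(t)-\beta(t)|=O\left(\frac{\sqrt{\log n}}{n^{\frac12\cdot\frac{m}{m+c}}}\right),$$ where each $O(\cdot)$ statement means that there is a constant $K<\infty$ such that the left side is at most $K$ times the stated rate with probability converging to one as $n\to\infty$.
   Context: Model: for each $n$, $Y_i=\int_0^1X_i(t)\beta(t)\,dt+\varepsilon_i$, $i=1,\dots,n$ (the intercept is taken to be $0$), where $X_i:[0,1]\to\mathbb{R}$ are functional predictors, $\beta:[0,1]\to\mathbb{R}$ is the fixed coefficient function and $\varepsilon_i$ are random errors. Distributional statements are conditional on the $X_i$ (which may be treated as fixed). For each $p$, $\mathbf{B}_p(t)=(b_1(t),\dots,b_p(t))^T$ is a given $p$-dimensional basis on $[0,1]$, $\boldsymbol{\eta}_p\in\mathbb{R}^p$, $e_p(t)=\beta(t)-\mathbf{B}_p(t)^T\boldsymbol{\eta}_p$, $\omega_p=\sup_{0\le t\le1}|e_p(t)|$, $A$ (depending on $p$) is an invertible $p\times p$ matrix, $\boldsymbol{\gamma}_p=A\boldsymbol{\eta}_p$, and $S_p$ bounds the number of non-zero components of $\boldsymbol\gamma_p$. All integrals are assumed to exist; $t$ ranges over $[0,1]$ in suprema. ''$p_n$ grows at the rate of $r_n$'' means that $p_n/r_n$ is bounded and bounded away from zero. Put $\mathbf{X}_i=\int_0^1X_i(t)\mathbf{B}_p(t)\,dt\in\mathbb{R}^p$,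 let $X$ be the $n\times p$ matrix with rows $\mathbf{X}_i^T$, let $V=V_{n,p}=XA^{-1}$, and let $\varepsilon_i^*=\varepsilon_i+\int_0^1X_i(t)e_p(t)\,dt$, so that $\mathbf{Y}=V\boldsymbol{\gamma}_p+\boldsymbol{\varepsilon}^*$. The columns of $V$ are assumed non-zero; $\tilde V$ is $V$ with each column divided by its Euclidean norm, and $\tilde V_j$ is its $j$th column. FLiRTI estimate with tuning parameter $\lambda$: let $\widehat{\tilde{\boldsymbol\gamma}}$ be either a lasso solution, minimizing $\frac12\|\mathbf{Y}-\tilde V\mathbf{g}\|_2^2+\lambda\|\mathbf{g}\|_1$ over $\mathbf{g}\in\mathbb{R}^p$, or a Dantzig selector solution, minimizing $\|\mathbf{g}\|_1$ subject to $|\tilde V_j^T(\mathbf{Y}-\tilde V\mathbf{g})|\le\lambda$ for $j=1,\dots,p$. Then $\widehat{\boldsymbol\gamma}$ is obtained by dividing the $j$th component of $\widehat{\tilde{\boldsymbol\gamma}}$ by the Euclidean norm of the $j$th column of $V$, and $\widehat\beta(t)=\mathbf{B}_p(t)^TA^{-1}\widehat{\boldsymbol\gamma}$. $D_\lambda$ is the diagonal matrix with $j$th diagonal entry $1,-1$ or $0$ according to whether the $j$th component of the lasso solution with tuning parameter $\lambda$ is positive, negative or zero; $\mathbf{1}$ is a vector of ones; vector inequalities are componentwise; the inverse of $D_\lambda\tilde V^T\tilde VD_\lambda$ is understood on the coordinates where the diagonal of $D_\lambda$ is non-zero. For an $n\times p$ matrix $Z$ and $T\subset\{1,\dots,p\}$,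 $Z_T$ is the $n\times|T|$ matrix obtained by standardizing the columns of $Z$ to Euclidean norm one and extracting those with indices in $T$. $\delta^Z_S$ is the smallest quantity such that $(1-\delta_S^Z)\|\mathbf{c}\|_2^2\le\|Z_T\mathbf{c}\|_2^2\le(1+\delta_S^Z)\|\mathbf{c}\|_2^2$ for all $T$ with $|T|\le S$ and all $\mathbf{c}\in\mathbb{R}^{|T|}$. For $S+S'\le p$, $\theta^Z_{S,S'}$ is the smallest quantity such that $|(Z_T\mathbf{c})^TZ_{T'}\mathbf{c}'|\le\theta^Z_{S,S'}\|\mathbf{c}\|_2\|\mathbf{c}'\|_2$ for all disjoint $T,T'$ with $|T|\le S$, $|T'|\le S'$ and all vectors $\mathbf{c},\mathbf{c}'$ of corresponding lengths. Finally, $$\alpha_{n,p}(t)=\sqrt{\sum_{j=1}^p\frac{(\mathbf{B}_p(t)^TA_j^{-1})^2}{\frac1n\sum_{i=1}^n\left(\int_0^1X_i(s)\mathbf{B}_p(s)^TA_j^{-1}\,ds\right)^2}},$$ where $A_j^{-1}$ is the $j$th column of $A^{-1}$. *)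

(* Defs.v *)
From mathcomp Require Import all_boot all_order all_algebra.
From mathcomp Require Import all_classical all_reals all_analysis.
Import Order.TTheory GRing.Theory Num.Theory numFieldNormedType.Exports.

Set Implicit Arguments.
Unset Strict Implicit.
Unset Printing Implicit Defensive.

Local Open Scope classical_set_scope.
Local Open Scope ring_scope.

Section LinearAlgebra.
Variable R : realType.

(* The library's matrix norm is the maximum norm, hence these two. *)
Definition l2norm n (v : 'cV[R]_n) : R := Num.sqrt (\sum_i v i 0 ^+ 2).
Definition l1norm n (v : 'cV[R]_n) : R := \sum_i `|v i 0|.

Definition nnonzero p (v : 'cV[R]_p) : nat := #|[set j | v j 0 != 0]%SET|.

Definition standardize n p (Z : 'M[R]_(n, p)) : 'M[R]_(n, p) :=
  \matrix_(i, j) (Z i j / l2norm (col j Z)).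

Definition std_cols n p (Z : 'M[R]_(n, p)) (T : {set 'I_p}) :
    'M[R]_(n, #|T|) :=
  colsub (fun k : 'I_#|T| => enum_val k) (standardize Z).

(* The constraint 0 <= d is automatic unless no non-empty set of columns is
   allowed; in that degenerate case it makes the smallest constant 0. *)
Definition delta n p (Z : 'M[R]_(n, p)) (S : nat) : R :=
  inf [set d : R | 0 <= d /\
    forall (T : {set 'I_p}) (c : 'cV[R]_#|T|), (#|T| <= S)%N ->
      (1 - d) * l2norm c ^+ 2 <= l2norm (std_cols Z T *m c) ^+ 2 /\
      l2norm (std_cols Z T *m c) ^+ 2 <= (1 + d) * l2norm c ^+ 2].

(* Disjointness forces #|T| + #|T'| <= p, so no condition S + S' <= p is
   needed for this to make sense. *)
Definition theta n p (Z : 'M[R]_(n, p)) (S S' : nat) : R :=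
  inf [set d : R | 0 <= d /\
    forall (T T' : {set 'I_p}) (c : 'cV[R]_#|T|) (c' : 'cV[R]_#|T'|),
      [disjoint T & T']%B -> (#|T| <= S)%N -> (#|T'| <= S')%N ->
      `|((std_cols Z T *m c)^T *m (std_cols Z T' *m c')) 0 0|
        <= d * l2norm c * l2norm c'].

Definition lasso_solution n p (W : 'M[R]_(n, p)) (Y : 'cV[R]_n) (lam : R)
    (g : 'cV[R]_p) : Prop :=
  forall h : 'cV[R]_p,
    2^-1 * l2norm (Y - W *m g) ^+ 2 + lam * l1norm g
      <= 2^-1 * l2norm (Y - W *m h) ^+ 2 + lam * l1norm h.

Definition dantzig_feasible n p (W : 'M[R]_(n, p)) (Y : 'cV[R]_n) (lam : R)
    (g : 'cV[R]_p) : Prop :=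
  forall j : 'I_p, `|((col j W)^T *m (Y - W *m g)) 0 0| <= lam.

Definition dantzig_solution n p (W : 'M[R]_(n, p)) (Y : 'cV[R]_n) (lam : R)
    (g : 'cV[R]_p) : Prop :=
  dantzig_feasible W Y lam g /\
  forall h : 'cV[R]_p, dantzig_feasible W Y lam h -> l1norm g <= l1norm h.

Definition sign_mx p (g : 'cV[R]_p) : 'M[R]_p :=
  diag_mx (\row_j Num.sg (g j 0)).

(* u = (D W^T W D)^-1 1 is a vector indexed by the coordinates where the
   diagonal of D = sign_mx g is non-zero; this inverse is required to exist,
   and W^T W D u is the combination with coefficients u of the corresponding
   columns of W^T W D. *)
Definition lasso_condition n p (W : 'M[R]_(n, p)) (g : 'cV[R]_p) : Prop :=
  let D := sign_mx g in
  let T := [set j | D j j != 0]%SET in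
  let active := fun k : 'I_#|T| => enum_val k in
  let M := mxsub active active (D *m W^T *m W *m D) in
  let u := invmx M *m (const_mx 1 : 'cV[R]_#|T|) in
  [/\ M \in unitmx,
      forall k, 0 <= u k 0
    & forall j, `|(colsub active (W^T *m W *m D) *m u) j 0| <= 1].

End LinearAlgebra.

Section FunctionalRegression.
Variable R : realType.

Definition int01 (f : R -> R) : R := \int[lebesgue_measure]_(s in `[0, 1]) f s.

Definition integrable01 (f : R -> R) : Prop :=
  lebesgue_measure.-integrable `[0, 1] (EFin \o f).

(* Supremum over [0, 1] in the extended reals: +oo if f is unbounded there. *)
Definition sup01 (f : R -> R) : \bar R := ereal_sup [set (f t)%:E | t in `[0, 1]].

Definition basis01 p (B : R -> 'cV[R]_p) : Prop :=
  forall c : 'cV[R]_p,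
    (forall t, t \in `[0, 1] -> ((B t)^T *m c) 0 0 = 0) -> c = 0.

Definition approx_err p (beta : R -> R) (B : R -> 'cV[R]_p) (eta : 'cV[R]_p)
    (t : R) : R :=
  beta t - ((B t)^T *m eta) 0 0.

Definition omega p (beta : R -> R) (B : R -> 'cV[R]_p) (eta : 'cV[R]_p) : \bar R :=
  sup01 (fun t => `|approx_err beta B eta t|).

Definition design n p (X : 'I_n -> R -> R) (B : R -> 'cV[R]_p) : 'M[R]_(n, p) :=
  \matrix_(i, j) int01 (fun s => X i s * B s j 0).

Definition Vmx n p (X : 'I_n -> R -> R) (B : R -> 'cV[R]_p) (A : 'M[R]_p) :
    'M[R]_(n, p) :=
  design X B *m invmx A.

(* x / 0 = 0, so a zero denominator contributes 0; the j-th denominator is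
   the squared Euclidean norm of the j-th column of Vmx X B A, divided by n
   (when the integrals exist). *)
Definition alpha n p (X : 'I_n -> R -> R) (B : R -> 'cV[R]_p) (A : 'M[R]_p)
    (t : R) : R :=
  Num.sqrt (\sum_j
    ((B t)^T *m col j (invmx A)) 0 0 ^+ 2 /
    (n%:R^-1 *
     \sum_i int01 (fun s => X i s * ((B s)^T *m col j (invmx A)) 0 0) ^+ 2)).

Definition response n (X : 'I_n -> R -> R) (beta : R -> R) (eps : 'cV[R]_n) :
    'cV[R]_n :=
  \col_i (int01 (fun s => X i s * beta s) + eps i 0).

Definition flirti n p (B : R -> 'cV[R]_p) (A : 'M[R]_p) (V : 'M[R]_(n, p))
    (g : 'cV[R]_p) (t : R) : R :=
  ((B t)^T *m (invmx A *m \col_j (g j 0 / l2norm (col j V)))) 0 0.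

Definition grows_at_rate (p : nat -> nat) (r : nat -> R) : Prop :=
  exists a b : R, 0 < a /\
    forall n, (0 < n)%N -> a <= (p n)%:R / r n /\ (p n)%:R / r n <= b.

End FunctionalRegression.

Section Probability.
Context d (Omega : measurableType d) (R : realType) (P : probability Omega R).

(* Product rule for all subfamilies and all measurable (Borel) sets. *)
Definition independent_family n (Z : 'I_n -> Omega -> R) : Prop :=
  forall (J : {set 'I_n}) (E : 'I_n -> set R),
    (forall i, measurable (E i)) ->
    P (\bigcap_(i in [set` J]) (Z i @^-1` E i)) =
      (\prod_(i in J) P (Z i @^-1` E i))%E.

(* normal_prob takes the standard deviation; the two are compared on Borel
   sets only. *)
Definition has_normal_law (Z : Omega -> R) (mu sigma : R) : Prop :=
  forall E : set R, measurable E ->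
    pushforward P Z E = normal_prob mu sigma E.

(* The events Q n need not be measurable (solutions of the optimization
   problems need not be unique, and suprema are uncountable), so their
   probability is bounded below by that of measurable sub-events; for
   measurable Q n this says exactly that P (Q n) tends to 1. *)
Definition with_prob_to_one (Q : nat -> set Omega) : Prop :=
  exists E : nat -> set Omega,
    (forall n, measurable (E n)) /\
    (forall n, E n `<=` Q n) /\
    P (E n) @[n --> \oo] --> 1%E.

End Probability.

(* Main.v *)
Require Import Defs.
From mathcomp Require Import all_boot all_order all_algebra.
From mathcomp Require Import all_classical all_reals all_analysis.
From mathcomp Require Import measurable_realfun lra ring.
Import Order.TTheory GRing.Theory Num.Theory numFieldNormedType.Exports.

Set Implicit Arguments.
Unset Strict Implicit.
Unset Printing Implicit Defensive.

Local Open Scope classical_set_scope.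
Local Open Scope ring_scope.

(** Let [W] be the design matrix [V] with its columns divided by their norms,
    and let [h] be the difference between the estimated and the true
    coefficients, both in the coordinates belonging to [W].

    At each point [s], the error [betahat s - beta s] is a linear function of
    [h] minus the approximation error of the basis. The Euclidean norm of that
    linear function is [alpha s / sqrt n], hence, by Cauchy-Schwarz,
    [|betahat s - beta s| <= alpha s / sqrt n * ||h|| + |approx_err s|]
    ([flirti_error_le]).

    The norm of [h] is controlled on the event that every column of [W] has an
    inner product of absolute value at most [lam] with the noise. There the true
    coefficients, those of the approximation of [beta] in the basis, are
    feasible for the Dantzig selector, so that the l1 norm of [h] off their
    support is at most its l1 norm on the support, while every column of [W] has
    an inner product of absolute value at most [2 * lam] with [W *m h]. If
    [delta + theta <= 1 - kappa], such a vector satisfies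
    [||h|| <= 16 * sqrt S * lam / kappa] ([cone_l2norm_le],
    [dantzig_l2norm_le]). Under [lasso_condition], a lasso solution is a
    solution of the Dantzig problem, because the vector [D u] is a dual
    certificate ([lasso_dantzig]).

    The inner product of a column of [W] with the noise is a combination of
    independent normal variables whose coefficients have norm one, so it is
    normal with the same variance ([normal_sum]). The union bound over the [p]
    columns, with Mills' bound for the tail ([normal_prob_norm_gt_le]), shows
    that the event fails with probability at most of order [1 / lam]
    ([noise_level_tail]). The factor [1 / lam], which Chernoff's bound does not
    give, is what makes this tend to zero when [phi = 0].

    For [p] of order [n ^ (1 / (2 m + 2 b))], the bounds on the two parts of the
    error are of the same order up to the factor [sqrt (ln n)] ([rate_le]). As
    the event does not depend on [s], the pointwise and the uniform rates have
    the same proof. *)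

(** * Euclidean norms and restrictions of vectors *)

Section Euclidean.
Import mathcomp.boot.fintype mathcomp.boot.finset.
Variable R : realType.

(** The inner product of column vectors, as a scalar. *)
Definition dotp n (u v : 'cV[R]_n) : R := \sum_i u i 0 * v i 0.

Lemma trmx_mulE n (u v : 'cV[R]_n) : (u^T *m v) 0 0 = dotp u v.
Proof. by rewrite mxE; apply: eq_bigr => i _; rewrite mxE. Qed.

Lemma dotpC n (u v : 'cV[R]_n) : dotp u v = dotp v u.
Proof. by apply: eq_bigr => i _; rewrite mulrC. Qed.

Lemma dotpDl n (u v w : 'cV[R]_n) : dotp (u + v) w = dotp u w + dotp v w.
Proof. by rewrite -big_split; apply: eq_bigr => i _; rewrite mxE mulrDl. Qed.

Lemma dotpZl n a (u w : 'cV[R]_n) : dotp (a *: u) w = a * dotp u w.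
Proof. by rewrite mulr_sumr; apply: eq_bigr => i _; rewrite mxE mulrA. Qed.

Lemma dotpBl n (u v w : 'cV[R]_n) : dotp (u - v) w = dotp u w - dotp v w.
Proof. by rewrite dotpDl -scaleN1r dotpZl mulN1r. Qed.

Lemma dotpBr n (u v w : 'cV[R]_n) : dotp w (u - v) = dotp w u - dotp w v.
Proof. by rewrite dotpC dotpBl !(dotpC w). Qed.

Lemma dotpZr n a (u w : 'cV[R]_n) : dotp w (a *: u) = a * dotp w u.
Proof. by rewrite dotpC dotpZl dotpC. Qed.

Lemma dotp_mulmxl n p (W : 'M[R]_(n, p)) (x : 'cV[R]_p) (w : 'cV[R]_n) :
  dotp (W *m x) w = \sum_j x j 0 * dotp (col j W) w.
Proof.
rewrite /dotp; under eq_bigr do rewrite mxE mulr_suml.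
rewrite exchange_big; apply: eq_bigr => j _; rewrite mulr_sumr.
by apply: eq_bigr => i _; rewrite mxE mulrCA mulrA.
Qed.

Lemma dotpp_ge0 n (u : 'cV[R]_n) : 0 <= dotp u u.
Proof. by apply: sumr_ge0 => i _; rewrite -expr2 sqr_ge0. Qed.

Lemma sqr_l2norm n (u : 'cV[R]_n) : l2norm u ^+ 2 = dotp u u.
Proof.
rewrite sqr_sqrtr; last by apply: sumr_ge0 => i _; exact: sqr_ge0.
by apply: eq_bigr => i _; rewrite expr2.
Qed.

Lemma l2norm_ge0 n (u : 'cV[R]_n) : 0 <= l2norm u.
Proof. exact: sqrtr_ge0. Qed.

Lemma l2norm_gt0 n (u : 'cV[R]_n) : u != 0 -> 0 < l2norm u.
Proof.
move=> u0; rewrite lt_def l2norm_ge0 andbT; apply: contra u0 => /eqP u0.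
have s0 : dotp u u = 0 by rewrite -sqr_l2norm u0 expr0n.
apply/eqP/matrixP => i j; rewrite ord1 mxE.
move/eqP: s0; rewrite /dotp psumr_eq0; last by move=> k _; rewrite -expr2 sqr_ge0.
by move=> /allP/(_ i (mem_index_enum _)); rewrite -expr2 sqrf_eq0 => /eqP.
Qed.

(** Cauchy-Schwarz for sums over part of a finite type. *)
Lemma sqr_sum_mul_le (I : finType) (P : pred I) (x y : I -> R) :
  (\sum_(i | P i) x i * y i) ^+ 2 <=
  (\sum_(i | P i) x i ^+ 2) * (\sum_(i | P i) y i ^+ 2).
Proof.
set xy := \sum_(i | P i) x i * y i; set xx := (\sum_(i | P i) x i ^+ 2).
set yy := (\sum_(i | P i) y i ^+ 2).
have xx0 : 0 <= xx by apply: sumr_ge0 => i _; exact: sqr_ge0.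
have yy0 : 0 <= yy by apply: sumr_ge0 => i _; exact: sqr_ge0.
have key : \sum_(i | P i) (yy * x i - xy * y i) ^+ 2 = yy * (xx * yy - xy ^+ 2).
  transitivity (\sum_(i | P i) (yy ^+ 2 * x i ^+ 2
      + (- (2 * yy * xy) * (x i * y i) + xy ^+ 2 * y i ^+ 2))).
    by apply: eq_bigr => i _; ring.
  rewrite !big_split/= -!mulr_sumr -/xy -/xx -/yy; ring.
have h : 0 <= yy * (xx * yy - xy ^+ 2).
  by rewrite -key; apply: sumr_ge0 => i _; exact: sqr_ge0.
have [yy0'|yyn0] := eqVneq yy 0.
  suff -> : xy = 0 by rewrite expr0n yy0' mulr0.
  rewrite /xy big1// => i Pi.
  move/eqP: yy0'; rewrite /yy psumr_eq0; last by move=> *; exact: sqr_ge0.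
  move=> /allP/(_ i (mem_index_enum _)); rewrite Pi sqrf_eq0 => /eqP ->.
  by rewrite mulr0.
by move: h; rewrite pmulr_rge0 ?subr_ge0// lt_def yyn0.
Qed.

Lemma normr_sum_mul_le (I : finType) (P : pred I) (x y : I -> R) :
  `|\sum_(i | P i) x i * y i| <=
  Num.sqrt (\sum_(i | P i) x i ^+ 2) * Num.sqrt (\sum_(i | P i) y i ^+ 2).
Proof.
rewrite -sqrtr_sqr -sqrtrM; last by apply: sumr_ge0 => i _; exact: sqr_ge0.
exact/ler_wsqrtr/sqr_sum_mul_le.
Qed.

Lemma dotp_le n (u v : 'cV[R]_n) : `|dotp u v| <= l2norm u * l2norm v.
Proof. exact: normr_sum_mul_le. Qed.

Lemma l2norm_mulmx_le n p (W : 'M[R]_(n, p)) :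
  exists2 C : R, 0 <= C &
    forall x : 'cV[R]_p, l2norm (W *m x) ^+ 2 <= C * l2norm x ^+ 2.
Proof.
exists (\sum_i \sum_j W i j ^+ 2).
  by apply: sumr_ge0 => i _; apply: sumr_ge0 => j _; exact: sqr_ge0.
move=> x; rewrite !sqr_l2norm /dotp mulr_suml; apply: ler_sum => i _.
by rewrite -expr2 mxE (le_trans (sqr_sum_mul_le _ _ _)).
Qed.

Lemma sum_setU_disjoint (I : finType) (T U : {set I}) (F : I -> R) :
  [disjoint T & U]%B ->
  \sum_(i in T :|: U) F i = \sum_(i in T) F i + \sum_(i in U) F i.
Proof.
by move=> dTU; rewrite -bigU//; apply: eq_bigl => i; rewrite inE.
Qed.

(** The vector that agrees with [h] on the coordinates in [T] and vanishes
    elsewhere. *)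
Definition res p (T : {set 'I_p}) (h : 'cV[R]_p) : 'cV[R]_p :=
  \col_j (if j \in T then h j 0 else 0).

Lemma res_setT p (h : 'cV[R]_p) : res [set: 'I_p] h = h.
Proof. by apply/matrixP => i j; rewrite ord1 mxE inE. Qed.

Lemma resU p (T U : {set 'I_p}) (h : 'cV[R]_p) : [disjoint T & U]%B ->
  res (T :|: U) h = res T h + res U h.
Proof.
move=> dTU; apply/matrixP => i j; rewrite ord1 !mxE inE.
by case: ifPn => [/orP[] iT|/norP[/negbTE -> /negbTE ->]]; rewrite ?addr0// iT
  ?(disjointFr dTU iT) ?(disjointFl dTU iT) ?addr0 ?add0r.
Qed.

Lemma sqr_l2norm_res p (T : {set 'I_p}) (h : 'cV[R]_p) :
  l2norm (res T h) ^+ 2 = \sum_(j in T) h j 0 ^+ 2.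
Proof.
rewrite sqr_l2norm [RHS]big_mkcond; apply: eq_bigr => j _.
by rewrite mxE; case: ifP => _; rewrite ?mulr0// expr2.
Qed.

Lemma dotp_mulmx_res n p (W : 'M[R]_(n, p)) (T : {set 'I_p}) h w :
  dotp (W *m res T h) w = \sum_(j in T) h j 0 * dotp (col j W) w.
Proof.
rewrite dotp_mulmxl [RHS]big_mkcond; apply: eq_bigr => j _.
by rewrite mxE; case: ifP => _; rewrite ?mul0r.
Qed.

Lemma sum_norm_res_le p (T : {set 'I_p}) (h : 'cV[R]_p) (k : nat) :
  (#|T| <= k)%N ->
  \sum_(j in T) `|h j 0| <= Num.sqrt k%:R * l2norm (res T h).
Proof.
move=> Tk; rewrite -[leLHS]ger0_norm; last exact: sumr_ge0.
have := normr_sum_mul_le (mem T) (fun=> 1) (fun j => `|h j 0|).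
under eq_bigr do rewrite mul1r.
move=> /le_trans; apply; apply: ler_pM; rewrite ?sqrtr_ge0//.
  apply: ler_wsqrtr; under eq_bigr do rewrite expr1n.
  by rewrite sumr_const ler_nat.
apply: ler_wsqrtr; rewrite [leRHS](_ : _ = l2norm (res T h) ^+ 2).
  by rewrite sqr_l2norm_res; under eq_bigr do rewrite real_normK ?num_real//.
by rewrite sqr_l2norm; apply: eq_bigr => j _; rewrite expr2.
Qed.

Lemma res_l2norm_le p (T U : {set 'I_p}) (h : 'cV[R]_p) : T \subset U ->
  l2norm (res T h) <= l2norm (res U h).
Proof.
move=> TU; rewrite -(@ler_pXn2r _ 2)// ?nnegrE ?l2norm_ge0// !sqr_l2norm_res.
rewrite [leRHS](big_setID T)/= (setIidPr TU) lerDl.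
by apply: sumr_ge0 => *; exact: sqr_ge0.
Qed.

End Euclidean.

Section SparseRecovery.
Import mathcomp.boot.fintype mathcomp.boot.finset.
Variables (R : realType) (n p : nat) (W : 'M[R]_(n, p)).
Implicit Types (T U : {set 'I_p}) (h : 'cV[R]_p).

(** Selecting the [S] largest coordinates of [h] among those in [U]: every
    coordinate left out is bounded by the average of the selected ones. If [U]
    has at most [S] elements, none is left out. *)
Lemma largest_block h S U : (0 < S)%N -> exists T : {set 'I_p},
  [/\ T \subset U, (#|T| <= S)%N, (U != set0 -> T != set0)%SET &
      forall j, j \in U :\: T -> `|h j 0| <= (\sum_(i in T) `|h i 0|) / S%:R].
Proof.
move=> S0.
have [US|SU] := leqP #|U| S.
  by exists U; split => // j; rewrite setDv inE.
have : exists T : {set 'I_p}, [/\ T \subset U, #|T| = S &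
    forall i j, i \in T -> j \in U :\: T -> `|h j 0| <= `|h i 0|].
  move/ltnW: SU; elim: S {S0} => [_|k IH kU].
    by exists set0; split; rewrite ?sub0set ?cards0// => i j; rewrite inE.
  have [T [TU Tk hT]] := IH (ltnW kU).
  have [j0 j0D] : exists j, j \in U :\: T.
    by apply/set0Pn; rewrite -card_gt0 cardsDS// Tk subn_gt0.
  pose j1 := [arg max_(j > j0 in U :\: T) `|h j 0|]%O.
  have [j1D j1max] : j1 \in U :\: T /\
      forall j, j \in U :\: T -> `|h j 0| <= `|h j1 0|.
    by rewrite /j1; case: Order.TotalTheory.arg_maxP.
  move: (j1D); rewrite inE => /andP[j1T j1U].
  exists (j1 |: T); split.
  - by rewrite subUset sub1set j1U.
  - by rewrite cardsU1 j1T Tk.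
  - move=> i j /setU1P[->|iT]; rewrite !inE negb_or => /andP[/andP[_ jT] jU].
      by apply: j1max; rewrite inE jT.
    by apply: hT => //; rewrite inE jT.
move=> [T [TU TS hT]]; exists T; split => //; first by rewrite TS.
  by move=> _; rewrite -card_gt0 TS.
move=> j jD; rewrite ler_pdivlMr ?ltr0n// mulr_natr -TS -sumr_const.
by apply: ler_sum => i iT; exact: hT.
Qed.

(** If the combinations of at most [S] columns in [U] are almost orthogonal to
    [w], so is that of all the columns in [U], up to the l1 norm and a bound [M]
    on the coefficients: peel off blocks of [S] coordinates in decreasing
    order, and bound the coefficients in a block by the average of those in the
    block before. *)
Lemma near_orthogonal_peeling h (w : 'cV[R]_n) (th : R) S U M :
  (0 < S)%N -> 0 <= th -> 0 <= M ->
  (forall T, T \subset U -> (#|T| <= S)%N ->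
     `|dotp (W *m res T h) w| <= th * l2norm (res T h)) ->
  (forall j, j \in U -> `|h j 0| <= M) ->
  `|dotp (W *m res U h) w| <=
    th * (Num.sqrt S%:R * M + (\sum_(j in U) `|h j 0|) / Num.sqrt S%:R).
Proof.
move=> S0 th0.
have sS0 : 0 < Num.sqrt S%:R :> R by rewrite sqrtr_gt0 ltr0n.
have [k] := ubnP #|U|; elim: k U M => // k IH U M; rewrite ltnS => Uk M0 hU hM.
have [T [TU TS TN hT]] := largest_block h U S0.
have [U0|UN] := eqVneq U set0.
  rewrite dotp_mulmx_res U0 big_set0 normr0 mulr_ge0// addr_ge0//.
    by rewrite mulr_ge0// ltW.
  by rewrite divr_ge0 ?(ltW sS0)// sumr_ge0.
have dTU : [disjoint T & U :\: T]%B 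
  by rewrite disjoints_subset; apply/fintype.subsetP => x xT; rewrite !inE xT.
rewrite -{1}(setID U T) (setIidPr TU) resU// mulmxDr dotpDl.
rewrite (le_trans (ler_normD _ _))// [in leRHS](big_setID T)/= (setIidPr TU).
set sT := \sum_(i in T) _ in hT *; set sD := \sum_(i in _ :\: _) _.
have sT0 : 0 <= sT by exact: sumr_ge0.
have le1 : `|dotp (W *m res T h) w| <= th * (Num.sqrt S%:R * M).
  rewrite (le_trans (hU _ TU TS))// ler_wpM2l//.
  rewrite -(@ler_pXn2r _ 2)// ?nnegrE ?l2norm_ge0 ?(mulr_ge0 (ltW sS0))//.
  rewrite sqr_l2norm_res exprMn sqr_sqrtr ?ler0n//.
  apply: (@le_trans _ _ (\sum_(j in T) M ^+ 2)).
    apply: ler_sum => j jT; rewrite -real_normK ?num_real// ler_pXn2r ?nnegrE//.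
    exact/hM/(fintype.subsetP TU).
  by rewrite sumr_const -[leLHS]mulr_natl ler_wpM2r ?sqr_ge0// ler_nat.
have le2 : `|dotp (W *m res (U :\: T) h) w| <=
    th * (Num.sqrt S%:R * (sT / S%:R) + sD / Num.sqrt S%:R).
  apply: IH => //.
  - rewrite cardsDS//; apply: leq_trans Uk.
    have /TN := UN; rewrite -card_gt0 => T1.
    have /subset_leq_card := TU; case: #|U| => [|u]; first by rewrite leqNgt T1.
    by move=> _; rewrite -{2}(subn0 u.+1) ltn_sub2l.
  - by rewrite divr_ge0.
  - move=> T' T'D; apply: hU.
    exact: fintype.subset_trans T'D (subsetDl _ _).
rewrite (le_trans (lerD le1 le2))// -mulrDr ler_wpM2l// lerD2l mulrDl lerD2r.
have eS : S%:R = Num.sqrt S%:R * Num.sqrt S%:R :> R.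
  by rewrite -expr2 sqr_sqrtr ?ler0n.
move: eS sS0; set s := Num.sqrt _ => -> sS0.
rewrite le_eqVlt; apply/orP; left; apply/eqP; field.
by rewrite gt_eqF.
Qed.

(** Restricted isometry and orthogonality, with constants [d] and [th], make
    the columns of [W] stable on the cone of vectors dominated, in the l1
    norm, by at most [S] of their coordinates. *)
Lemma cone_l2norm_le (S : nat) (d th lam : R) (T0 : {set 'I_p}) h :
  0 <= d -> 0 <= th -> d + th < 1 -> 0 <= lam ->
  (forall T, (#|T| <= 2 * S)%N ->
     (1 - d) * l2norm (res T h) ^+ 2 <= l2norm (W *m res T h) ^+ 2) ->
  (forall T T', [disjoint T & T']%B -> (#|T| <= S)%N -> (#|T'| <= 2 * S)%N ->
     `|dotp (W *m res T h) (W *m res T' h)| <=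
       th * l2norm (res T h) * l2norm (res T' h)) ->
  (#|T0| <= S)%N ->
  \sum_(j in ~: T0) `|h j 0| <= \sum_(j in T0) `|h j 0| ->
  (forall j, `|dotp (col j W) (W *m h)| <= 2 * lam) ->
  l2norm h <= 8 * Num.sqrt S%:R * lam / (1 - d - th).
Proof.
move=> d0 th0 dth lam0 hd hth T0S cone grad.
have kap0 : 0 < 1 - d - th by lra.
have rhs0 : 0 <= 8 * Num.sqrt S%:R * lam / (1 - d - th).
  by rewrite divr_ge0 ?(ltW kap0)// !mulr_ge0 ?sqrtr_ge0.
have [S0|S0] := posnP S.
  have hz j : h j 0 = 0.
    have T00 : T0 = set0.
      by apply/eqP; rewrite -cards_eq0; move: T0S; rewrite S0 leqn0.
    move: cone; rewrite T00 big_set0 => cone.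
    have /eqP : \sum_(j in ~: T0) `|h j 0| = 0.
      by apply/eqP; rewrite eq_le sumr_ge0// T00 andbT.
    rewrite psumr_eq0// => /allP/(_ j (mem_index_enum _)).
    by rewrite T00 !inE/= normr_eq0 => /eqP.
  rewrite (_ : l2norm h = 0)// /l2norm big1 ?sqrtr0// => j _.
  by rewrite hz expr0n.
have [T1 [T1U T1S _ hT1]] := largest_block h (~: T0) S0.
set s : R := Num.sqrt S%:R in rhs0 *.
have s0 : 0 < s by rewrite sqrtr_gt0 ltr0n.
have ss : S%:R = s * s by rewrite -expr2 sqr_sqrtr ?ler0n.
pose T01 := T0 :|: T1; pose Tr := ~: T01.
have T01S : (#|T01| <= 2 * S)%N.
  by rewrite mul2n -addnn (leq_trans (leq_card_setU _ _))// leq_add.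
pose a := l2norm (res T01 h).
have a0 : 0 <= a by exact: l2norm_ge0.
pose sU : R := \sum_(j in ~: T0) `|h j 0|.
have sU0 : 0 <= sU by exact: sumr_ge0.
have sT0a : \sum_(j in T0) `|h j 0| <= s * a.
  rewrite (le_trans (sum_norm_res_le h T0S))// ler_wpM2l ?(ltW s0)//.
  by apply: res_l2norm_le; exact: subsetUl.
have sUa : sU <= s * a by exact: le_trans sT0a.
have TrE : Tr = (~: T0) :\: T1 by rewrite /Tr /T01 setCU setDE.
have sUE : sU = \sum_(j in T1) `|h j 0| + \sum_(j in Tr) `|h j 0|.
  by rewrite /sU (big_setID T1)/= (setIidPr T1U) TrE.
have sT1U : \sum_(j in T1) `|h j 0| <= sU by rewrite sUE lerDl sumr_ge0.
have dT01r : [disjoint T01 & Tr]%B by rewrite disjoints_subset setCK.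
have hE : h = res T01 h + res Tr h.
  by rewrite -resU// setUCr res_setT.
(* the tail is almost orthogonal to the head *)
have tl_le : `|dotp (W *m res Tr h) (W *m res T01 h)| <= th * a * a.
  have M0 : 0 <= (\sum_(i in T1) `|h i 0|) / S%:R.
    by rewrite divr_ge0// sumr_ge0.
  have := @near_orthogonal_peeling h (W *m res T01 h) (th * a) S Tr
    _ S0 (mulr_ge0 th0 a0) M0.
  have H1 T : T \subset Tr -> (#|T| <= S)%N ->
      `|dotp (W *m res T h) (W *m res T01 h)| <= th * a * l2norm (res T h).
    move=> TTr TS; rewrite mulrAC; apply: hth => //.
    by rewrite disjoint_sym; exact: disjointWr dT01r.
  move=> /(_ H1) H2; rewrite (le_trans (H2 _))//.
    by move=> j; rewrite TrE; exact: hT1.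
  rewrite ler_wpM2l ?mulr_ge0//.
  rewrite -/s ss invfM mulrCA !mulrA mulfK ?gt_eqF// -mulrDl ler_pdivrMr//.
  by rewrite -sUE (mulrC a).
have hd_le : `|dotp (W *m res T01 h) (W *m h)| <= 2 * (s * a) * (2 * lam).
  rewrite dotp_mulmx_res (le_trans (ler_norm_sum _ _ _))//.
  apply: (@le_trans _ _ ((\sum_(j in T01) `|h j 0|) * (2 * lam))).
    rewrite mulr_suml; apply: ler_sum => j _; rewrite normrM ler_wpM2l//.
  rewrite ler_wpM2r ?mulr_ge0//.
  have dT : [disjoint T0 & T1]%B.
    by rewrite disjoint_sym disjoints_subset.
  rewrite sum_setU_disjoint//.
  by have := le_trans sT1U sUa; move: sT0a; lra.
have a_le : a <= 4 * s * lam / (1 - d - th).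
  have sq : (1 - d) * a ^+ 2 <= 2 * (s * a) * (2 * lam) + th * a * a.
    rewrite (le_trans (hd _ T01S))// sqr_l2norm.
    have -> : dotp (W *m res T01 h) (W *m res T01 h) =
        dotp (W *m res T01 h) (W *m h) - dotp (W *m res Tr h) (W *m res T01 h).
      rewrite (dotpC (_ *m res Tr h)) -dotpBr -mulmxBr.
      by rewrite (_ : h - res Tr h = res T01 h)// {1}hE addrK.
    move: hd_le tl_le; rewrite !ler_norml => /andP[_ hd1] /andP[tl1 _]; move: hd1 tl1.
    lra.
  have [->|an0] := eqVneq a 0; first by rewrite divr_ge0 ?(ltW kap0)// !mulr_ge0 ?(ltW s0).
  have ap : 0 < a by rewrite lt_def an0.
  rewrite ler_pdivlMr// -(ler_pM2r ap).
  move: sq; rewrite expr2; lra.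
have rest : l2norm (res Tr h) ^+ 2 <= a ^+ 2.
  rewrite sqr_l2norm_res.
  apply: (@le_trans _ _ (\sum_(j in Tr) `|h j 0| * (sU / S%:R))).
    apply: ler_sum => j; rewrite TrE => jT.
    rewrite -real_normK ?num_real// expr2 ler_wpM2l//.
    by rewrite (le_trans (hT1 _ jT))// ler_wpM2r ?invr_ge0.
  rewrite -mulr_suml ss.
  apply: (@le_trans _ _ (sU * (sU / (s * s)))).
    rewrite ler_wpM2r// ?divr_ge0 ?mulr_ge0 ?(ltW s0)//.
    by rewrite sUE lerDr sumr_ge0.
  rewrite invfM mulrA mulrACA -expr2 ler_pXn2r// ?nnegrE ?divr_ge0 ?(ltW s0)//.
  by rewrite ler_pdivrMr// mulrC.
have h2a : l2norm h <= 2 * a.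
  rewrite -(@ler_pXn2r _ 2)// ?nnegrE ?l2norm_ge0 ?mulr_ge0//.
  have -> : l2norm h ^+ 2 = a ^+ 2 + l2norm (res Tr h) ^+ 2.
    by rewrite /a -{1}(res_setT h) !sqr_l2norm_res -(setUCr T01) (sum_setU_disjoint _ dT01r).
  by move: rest (sqr_ge0 a); lra.
rewrite (le_trans h2a)//.
have -> : 8 * s * lam / (1 - d - th) = 2 * (4 * s * lam / (1 - d - th)).
  by rewrite !mulrA -natrM.
by rewrite ler_wpM2l.
Qed.

End SparseRecovery.

(** * Restricted constants, Dantzig selector and lasso *)

Section RestrictedConstants.
Variables (R : realType) (n p : nat) (Z : 'M[R]_(n, p)).
Implicit Types (T : {set 'I_p}) (h : 'cV[R]_p).

(** The coordinates of [h] in [T], as a vector indexed by the rank in [T]. *)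
Definition coords T h : 'cV[R]_#|T| := \col_k h (enum_val k) 0.

Lemma std_cols_coords T h :
  std_cols Z T *m coords T h = standardize Z *m res T h.
Proof.
apply/matrixP => i j; rewrite ord1 !mxE.
under [RHS]eq_bigr do rewrite 2!mxE.
rewrite [RHS](eq_bigr (fun k => if k \in T then Z i k / l2norm (col k Z) * h k 0 else 0)).
  rewrite -big_mkcond/= [RHS]big_enum_val; apply: eq_bigr => k _.
  by rewrite !mxE.
by move=> k _; case: ifP => _ //; rewrite mulr0.
Qed.

Lemma l2norm_coords T h : l2norm (coords T h) = l2norm (res T h).
Proof.
rewrite /l2norm; congr Num.sqrt.
rewrite [RHS](eq_bigr (fun k => if k \in T then h k 0 ^+ 2 else 0)).
  rewrite -big_mkcond/= [RHS]big_enum_val; apply: eq_bigr => k _.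
  by rewrite mxE.
by move=> k _; rewrite mxE; case: ifP => _ //; rewrite expr0n.
Qed.

(** The infimum [delta Z k] is approached by admissible constants: there are
    some, because [standardize Z] is a bounded operator. *)
Lemma delta_approx (k : nat) (e : R) : 0 < e -> exists d,
  [/\ 0 <= d, d < delta Z k + e &
    forall T h, (#|T| <= k)%N -> (1 - d) * l2norm (res T h) ^+ 2 <=
      l2norm (standardize Z *m res T h) ^+ 2].
Proof.
move=> e0; rewrite /delta; set D := [set d | _].
have hD : has_inf D.
  split; last by exists 0 => d -[].
  have [C C0 hC] := l2norm_mulmx_le (standardize Z).
  exists (C + 1); split; first by rewrite addr_ge0.
  move=> T c _.
  have -> : c = coords T (\col_j \sum_(k : 'I_#|T|) if enum_val k == j then c k 0 else 0).
    apply/matrixP => i j; rewrite ord1 !mxE (bigD1 i)//= eqxx big1 ?addr0// => l li.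
    by rewrite (inj_eq enum_val_inj) (negbTE li).
  rewrite std_cols_coords l2norm_coords.
  set x := res _ _; have x0 := sqr_ge0 (l2norm x); split.
    apply: (@le_trans _ _ 0); last exact: sqr_ge0.
    by rewrite mulr_le0_ge0//; lra.
  by rewrite (le_trans (hC _))// ler_wpM2r//; lra.
have [d [d0 hd] dlt] := inf_adherent e0 hD.
exists d; split => // T h Tk.
by have [+ _] := hd T (coords T h) Tk; rewrite std_cols_coords l2norm_coords.
Qed.

Lemma theta_approx (k l : nat) (e : R) : 0 < e -> exists d,
  [/\ 0 <= d, d < theta Z k l + e &
    forall T T' h, [disjoint T & T']%B -> (#|T| <= k)%N -> (#|T'| <= l)%N ->
      `|dotp (standardize Z *m res T h) (standardize Z *m res T' h)| <=
        d * l2norm (res T h) * l2norm (res T' h)].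
Proof.
move=> e0; rewrite /theta; set D := [set d | _].
have hD : has_inf D.
  split; last by exists 0 => d -[].
  have [C C0 hC] := l2norm_mulmx_le (standardize Z).
  exists C; split => // T T' c c' _ _ _.
  have cE (U : {set 'I_p}) (b : 'cV[R]_#|U|) : b =
      coords U (\col_j \sum_(k : 'I_#|U|) if enum_val k == j then b k 0 else 0).
    apply/matrixP => i j; rewrite ord1 !mxE (bigD1 i)//= eqxx big1 ?addr0// => q qi.
    by rewrite (inj_eq enum_val_inj) (negbTE qi).
  rewrite (cE _ c) (cE _ c') !std_cols_coords !l2norm_coords trmx_mulE.
  set x := res _ _; set x' := res _ _.
  rewrite (le_trans (dotp_le _ _))//.
  rewrite -(@ler_pXn2r _ 2)// ?nnegrE ?mulr_ge0 ?l2norm_ge0//.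
  rewrite !exprMn.
  have -> : C ^+ 2 * l2norm x ^+ 2 * l2norm x' ^+ 2 =
    (C * l2norm x ^+ 2) * (C * l2norm x' ^+ 2) by ring.
  by rewrite ler_pM ?sqr_ge0.
have [d [d0 hd] dlt] := inf_adherent e0 hD.
exists d; split => // T T' h TT' Tk Tl.
have := hd T T' (coords T h) (coords T' h) TT' Tk Tl.
by rewrite !std_cols_coords !l2norm_coords trmx_mulE.
Qed.

End RestrictedConstants.

Section Dantzig.
Variables (R : realType) (n p : nat).
Implicit Types (W Z : 'M[R]_(n, p)) (Y : 'cV[R]_n) (g h : 'cV[R]_p).

(** Error bound for the Dantzig selector: its difference from any feasible
    sparse vector is dominated by the coordinates of the support of the latter,
    and almost orthogonal to every column. *)
Lemma dantzig_l2norm_le Z Y lam g h (S : nat) kappa :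
  0 <= lam -> 0 < kappa -> delta Z (2 * S) + theta Z S (2 * S) <= 1 - kappa ->
  (nnonzero g <= S)%N -> dantzig_feasible (standardize Z) Y lam g ->
  dantzig_solution (standardize Z) Y lam h ->
  l2norm (h - g) <= 16 * Num.sqrt S%:R * lam / kappa.
Proof.
move=> lam0 kappa0 hdt gS fg [fh hmin].
(* a quarter of [kappa] for each infimum leaves a margin of [kappa / 2] *)
have k4 : 0 < kappa / 4 by rewrite divr_gt0.
have [d [d0 dlt hd]] := delta_approx Z (2 * S) k4.
have [th [th0 thlt hth]] := theta_approx Z S (2 * S) k4.
set W := standardize Z in fg fh hmin hd hth.
pose T0 := [set j | g j 0 != 0]%SET.
have gT0 j : j \notin T0 -> g j 0 = 0 by rewrite inE negbK => /eqP.
have cone : \sum_(j in ~: T0) `|(h - g) j 0| <= \sum_(j in T0) `|(h - g) j 0|.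
  have := hmin _ fg; rewrite /l1norm.
  rewrite (bigID (mem T0))/= [leRHS](bigID (mem T0))/= [X in _ <= _ + X]big1 ?addr0.
    move=> le1.
    rewrite (eq_bigl (fun j => j \notin T0)); last by move=> j; rewrite !inE.
    rewrite (eq_bigr (fun j => `|h j 0|)); last first.
      by move=> j jT; rewrite !mxE gT0// oppr0 addr0.
    have : \sum_(j in T0) `|g j 0| <= \sum_(j in T0) `|h j 0| +
        \sum_(j in T0) `|(h - g) j 0|.
      rewrite -big_split/=; apply: ler_sum => j _; rewrite !mxE.
      have {1}-> : g j 0 = h j 0 - (h j 0 - g j 0) by rewrite subKr.
      exact: ler_normB.
    by move: le1; lra.
  by move=> j jT; rewrite gT0// normr0.
have grad j : `|dotp (col j W) (W *m (h - g))| <= 2 * lam.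
  have -> : W *m (h - g) = (Y - W *m g) - (Y - W *m h).
    by rewrite mulmxBr; apply/matrixP => i k; rewrite !mxE; ring.
  rewrite dotpBr (le_trans (ler_normB _ _))// mulr2n mulrDl mul1r.
  by rewrite lerD// -trmx_mulE.
have dth : d + th < 1 by lra.
have := @cone_l2norm_le _ _ _ W S d th lam T0 (h - g) d0 th0 dth lam0
  (fun T => hd T _) (fun T T' => hth T T' _) gS cone grad.
move=> /le_trans; apply.
have -> : 16 * Num.sqrt S%:R * lam / kappa = 8 * Num.sqrt S%:R * lam / (kappa / 2).
  by field; rewrite gt_eqF.
rewrite ler_wpM2l ?mulr_ge0 ?sqrtr_ge0// lef_pV2 ?posrE ?divr_gt0//; lra.
Qed.

End Dantzig.

Section Lasso.
Variables (R : realType) (n p : nat) (W : 'M[R]_(n, p)) (Y : 'cV[R]_n).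
Implicit Types (g h : 'cV[R]_p).

Lemma le0_of_small (a b e : R) : 0 < e -> 0 <= b ->
  (forall t, 0 < t -> t <= e -> a <= t * b) -> a <= 0.
Proof.
move=> e0 b0 H; rewrite leNgt; apply/negP => a0.
pose t := Num.min e (a / (2 * (b + 1))).
have b1 : 0 < 2 * (b + 1) by lra.
have t0 : 0 < t by rewrite /t lt_min e0 divr_gt0.
have te : t <= e by rewrite /t ge_min lexx.
have ta : t * (2 * (b + 1)) <= a by rewrite -ler_pdivlMr// /t ge_min lexx orbT.
by have := H _ t0 te; nra.
Qed.

(** First-order optimality conditions of the lasso, from the comparison of the
    objective at [g] and at [g + t e_j] for small [t]. *)
Lemma lasso_KKT lam g : 0 <= lam -> lasso_solution W Y lam g ->
  forall j, `|dotp (col j W) (Y - W *m g)| <= lam /\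
    (g j 0 != 0 -> dotp (col j W) (Y - W *m g) = lam * Num.sg (g j 0)).
Proof.
move=> lam0 sol j; set r := dotp _ _; set x := g j 0.
pose q := dotp (col j W) (col j W).
have q0 : 0 <= q by exact: dotpp_ge0.
have H t : t * r <= t ^+ 2 * (q / 2) + lam * (`|x + t| - `|x|).
  have := sol (g + t *: delta_mx j 0).
  rewrite !sqr_l2norm mulmxDr -scalemxAr -colE opprD addrA.
  set w := Y - W *m g.
  have -> : dotp (w - t *: col j W) (w - t *: col j W) =
      dotp w w - 2 * (t * r) + t ^+ 2 * q.
    rewrite (dotpBl w) !(dotpBr w (t *: col j W)) !dotpZl !dotpZr (dotpC w (col j W)) -/r -/q; ring.
  have -> : l1norm (g + t *: delta_mx j 0) = l1norm g + (`|x + t| - `|x|).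
    rewrite /l1norm (bigD1 j)//= [in RHS](bigD1 j)//= !mxE !eqxx mulr1.
    rewrite (eq_bigr (fun i => `|g i 0|)); last first.
      by move=> i ij; rewrite !mxE (negbTE ij) mulr0 addr0.
    by rewrite -/x; ring.
  by rewrite -/w; lra.
have tri t : `|x + t| - `|x| <= `|t| by rewrite lerBlDl ler_normD.
split.
  rewrite ler_norml; apply/andP; split; rewrite -subr_le0.
    apply: (@le0_of_small _ (q / 2) 1) => //; first by rewrite divr_ge0.
    move=> t t0 _; rewrite -(ler_pM2l t0).
    have := H (- t); have := tri (- t); rewrite normrN (gtr0_norm t0) => h1 h2.
    have := ler_wpM2l lam0 h1; move: h2; rewrite sqrrN expr2; lra.
  apply: (@le0_of_small _ (q / 2) 1) => //; first by rewrite divr_ge0.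
  move=> t t0 _; rewrite -(ler_pM2l t0).
  have := H t; have := tri t; rewrite (gtr0_norm t0) => h1 h2.
  have := ler_wpM2l lam0 h1; move: h2; rewrite expr2; lra.
move=> x0.
have q2 : 0 <= q / 2 by rewrite divr_ge0.
have xn0 : 0 < `|x| by rewrite normr_gt0.
have lin t : `|t| <= `|x| -> `|x + t| - `|x| = Num.sg x * t.
  have [xp|xn|xe] := ltgtP x 0.
  - rewrite (ltr0_norm xp) ltr0_sg// ler_norml => /andP[_ h1].
    rewrite ler0_norm; lra.
  - rewrite (gtr0_norm xn) gtr0_sg// ler_norml => /andP[h1 _].
    rewrite ger0_norm; lra.
  - by rewrite xe eqxx in x0.
apply/eqP; rewrite eq_le; apply/andP; split; rewrite -subr_le0.
  apply: (le0_of_small xn0 q2) => t t0 tx; rewrite -(ler_pM2l t0).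
  by have := H t; rewrite lin ?(gtr0_norm t0)// expr2; lra.
apply: (le0_of_small xn0 q2) => t t0 tx; rewrite -(ler_pM2l t0).
have := H (- t); rewrite lin ?normrN ?(gtr0_norm t0)// sqrrN expr2; lra.
Qed.

(** Under [lasso_condition], the vector [D u] certifies, by linear
    programming duality, that the lasso solution has the least l1 norm among
    the feasible vectors of the Dantzig selector. *)
Lemma lasso_dantzig lam g : 0 <= lam -> lasso_solution W Y lam g ->
  lasso_condition W g -> dantzig_solution W Y lam g.
Proof.
move=> lam0 sol; have KKT := lasso_KKT lam0 sol.
rewrite /lasso_condition.
set D := sign_mx g; set T := [set j | _]%SET; set act := fun k => _.
set M := mxsub _ _ _; set u := invmx M *m _ => -[Mu u0 uinf].
have DE i j : D i j = Num.sg (g i 0) *+ (i == j) by rewrite !mxE.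
have feas : dantzig_feasible W Y lam g.
  by move=> j; rewrite trmx_mulE; case: (KKT j).
split => // h fh.
(* the dual certificate, supported on the active set *)
pose z := colsub act D *m u.
pose v := W^T *m W *m z.
have vE : v = colsub act (W^T *m W *m D) *m u.
  by rewrite /v /z mulmxA mulmx_colsub.
have v1 j : `|v j 0| <= 1 by rewrite vE.
have vj j : v j 0 = dotp (col j W) (W *m z).
  rewrite /v -mulmxA mxE; apply: eq_bigr => i _; rewrite mxE; congr (_ * _).
  by rewrite mxE.
have Mone : M *m u = const_mx 1 by rewrite /u mulKVmx.
have sgv j : g j 0 != 0 -> Num.sg (g j 0) * v j 0 = 1.
  move=> gj; have jT : j \in T by rewrite inE DE eqxx sgr_eq0.
  have := congr1 (fun A : 'cV[R]_#|T| => A (enum_rank_in jT j) 0) Mone.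
  rewrite [RHS]mxE => <-.
  rewrite vE [RHS]mxE [X in _ * X]mxE mulr_sumr; apply: eq_bigr => k _.
  rewrite mulrA; congr (_ * _).
  rewrite [RHS]mxE [X in _ * X]mxE -!mulmxA mul_diag_mx [RHS]mxE [X in _ = X * _]mxE.
  by rewrite /act enum_rankK_in// !mulmxA.
have gv : l1norm g = \sum_j g j 0 * v j 0.
  apply: eq_bigr => j _; have [->|gj] := eqVneq (g j 0) 0.
    by rewrite normr0 mul0r.
  by rewrite {2}(numEsg (g j 0)) mulrAC sgv// mul1r.
have hv : \sum_j h j 0 * v j 0 <= l1norm h.
  apply: ler_sum => j _; rewrite (le_trans (ler_norm _))// normrM.
  by rewrite ler_piMr.
rewrite gv (le_trans _ hv)// -subr_ge0 -sumrB.
have -> : \sum_j (h j 0 * v j 0 - g j 0 * v j 0) =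
    dotp (W *m z) (W *m (h - g)).
  rewrite dotpC dotp_mulmxl; apply: eq_bigr => j _.
  by rewrite -mulrBl vj !mxE.
have -> : W *m z = colsub act (W *m D) *m u by rewrite /z mulmxA mulmx_colsub.
have -> : W *m (h - g) = (Y - W *m g) - (Y - W *m h).
  by rewrite mulmxBr; apply/matrixP => i k; rewrite !mxE; ring.
rewrite dotp_mulmxl; apply: sumr_ge0 => k _; apply: mulr_ge0 => //.
have gk : g (act k) 0 != 0.
  by have := enum_valP k; rewrite inE DE eqxx sgr_eq0.
have -> : col k (colsub act (W *m D)) = Num.sg (g (act k) 0) *: col (act k) W.
  apply/matrixP => i l; rewrite mxE mxE mul_mx_diag !mxE.
  by rewrite mulrC.
rewrite dotpZl dotpBr (KKT _).2// mulrBr mulrCA -expr2 sqr_sg gk mulr1 subr_ge0.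
rewrite (le_trans (ler_norm _))// normrM normr_sg gk mul1r -trmx_mulE.
exact: fh.
Qed.

End Lasso.

(** * Normal laws *)

Section NormalLaw.
Variable R : realType.
Implicit Types (m s a b : R) (F : set R).
Local Notation mu := (@lebesgue_measure R).

Lemma eq_normal_prob m s s' : s ^+ 2 = s' ^+ 2 ->
  normal_prob m s = normal_prob m s' :> (set R -> \bar R).
Proof.
move=> ss'; suff : normal_pdf m s = normal_pdf m s'.
  by rewrite /normal_prob => ->.
apply/funext => x; rewrite /normal_pdf /normal_peak /normal_fun ss'.
by rewrite -(sqrf_eq0 s) ss' sqrf_eq0.
Qed.

Lemma measurable_affine a b : measurable_fun [set: R] (fun x => a * x + b).
Proof.
apply: measurable_realfun.measurable_funD => //.
Qed.

Lemma measurable_preimage_affine a b F : measurable F ->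
  measurable ((fun x => a * x + b) @^-1` F).
Proof. by move=> mF; rewrite -[X in measurable X]setTI; exact: measurable_affine. Qed.

Lemma lebesgue_measure_affine a b F : a != 0 -> measurable F ->
  mu F = (`|a|%:E * mu ((fun x => (a * x + b)%R) @^-1` F))%E.
Proof.
move=> a0 mF.
pose f (x : measurableTypeR R) : measurableTypeR R := a * x + b.
have mf : measurable_fun setT f by exact: measurable_affine.
have na : 0 <= `|a| by [].
pose nu : {measure set (measurableTypeR R) -> \bar R} :=
  mscale (NngNum na)
   (measure_function_pushforward__canonical__measure_function_Measure mu mf).
apply: (@lebesgue_measure_unique _ nu) => // _ [[c d] _ <-].
rewrite /nu /= /mscale/= /pushforward/=.
have [a_lt0|a_gt0|a_eq0] := ltgtP a 0; last by rewrite a_eq0 eqxx in a0.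
  have -> : f @^-1` `]c, d] = `[(d - b) / a, (c - b) / a[%classic.
    apply/seteqP; split => x /=; rewrite !in_itv/= /f.
      by rewrite ler_ndivrMr// ltr_ndivlMr// => /andP[? ?]; apply/andP; split; lra.
    by rewrite ler_ndivrMr// ltr_ndivlMr// => /andP[? ?]; apply/andP; split; lra.
  rewrite !lebesgue_measure_itv/= !lte_fin ltr_ndivrMr// mulfVK// ltrBlDr subrK.
  case: ifP => _; last by rewrite mule0.
  by rewrite -!EFinB -EFinM ltr0_norm//; congr EFin; field.
have -> : f @^-1` `]c, d] = `](c - b) / a, (d - b) / a]%classic.
  apply/seteqP; split => x /=; rewrite !in_itv/= /f.
    by rewrite ler_pdivlMr// ltr_pdivrMr// => /andP[? ?]; apply/andP; split; lra.
  by rewrite ler_pdivlMr// ltr_pdivrMr// => /andP[? ?]; apply/andP; split; lra.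
rewrite !lebesgue_measure_itv/= !lte_fin ltr_pdivrMr// mulfVK// ltrBlDr subrK.
case: ifP => _; last by rewrite mule0.
by rewrite -!EFinB -EFinM gtr0_norm//; congr EFin; field.
Qed.

Lemma normal_peakM a s : normal_peak (a * s) = `|a|^-1 * normal_peak s.
Proof.
rewrite /normal_peak exprMn -mulrA -mulrnAr sqrtrM ?sqr_ge0// sqrtr_sqr.
by rewrite invfM.
Qed.

Lemma normal_prob_affine m s a b F : a != 0 -> s != 0 -> measurable F ->
  normal_prob m s ((fun x => a * x + b) @^-1` F) =
  normal_prob (a * m + b) (a * s) F.
Proof.
move=> a0 s0 mF.
pose f (x : measurableTypeR R) : measurableTypeR R := a * x + b.
have mf : measurable_fun setT f by exact: measurable_affine.
have na : 0 <= `|a| by [].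
pose nu : {measure set (measurableTypeR R) -> \bar R} :=
   measure_function_pushforward__canonical__measure_function_Measure mu mf.
have as0 : a * s != 0 by rewrite mulf_neq0.
rewrite {2}/normal_prob.
pose nu2 : {measure set (measurableTypeR R) -> \bar R} := mscale (NngNum na) nu.
rewrite (@eq_measure_integral _ (measurableTypeR R) _ F nu2); last first.
  by move=> G mG _; exact: (lebesgue_measure_affine b a0 mG).
rewrite ge0_integral_mscale//=; last 2 first.
- by apply/measurable_EFinP/measurable_funTS; exact: measurable_normal_pdf.
- by move=> x _; rewrite lee_fin normal_pdf_ge0.
rewrite ge0_integral_pushforward//=; last 2 first.
- by apply/measurable_EFinP/measurable_funTS; exact: measurable_normal_pdf.
- by move=> x _; rewrite lee_fin normal_pdf_ge0.
rewrite -ge0_integralZl//=; last 3 first.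
- exact: measurable_preimage_affine.
- apply/measurable_EFinP/measurable_funTS; apply: measurableT_comp (measurable_affine a b).
  exact: measurable_normal_pdf.
- by move=> x _; rewrite lee_fin normal_pdf_ge0.
apply: eq_integral => x _; rewrite /= -EFinM !normal_pdfE//; congr EFin.
rewrite normal_peakM /normal_fun /f mulrA mulrA mulfV ?normr_eq0// mul1r.
congr (_ * expR _).
have -> : a * x + b - (a * m + b) = a * (x - m) by ring.
rewrite !exprMn -mulrnAr.
by field; rewrite a0 s0.
Qed.

Lemma integral_normal_prob m s (f : R -> \bar R) :
  (normal_prob m s).-integrable setT f ->
  (\int[normal_prob m s]_x f x = \int[mu]_x (f x * (normal_pdf m s x)%:E))%E.
Proof.
move=> intf.
have ds := normal_prob_dominates m s.
rewrite -(Radon_Nikodym_change_of_variables ds)//.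
have mf := measurable_int _ intf.
apply: ae_eq_integral => //=.
- apply: emeasurable_funM => //.
- apply: emeasurable_funM => //; apply/measurable_EFinP.
  exact: measurable_normal_pdf.
- have : ae_eq mu setT
      (Radon_Nikodym (charge_of_finite_measure (normal_prob m s)) mu)
      (EFin \o normal_pdf m s).
    apply: integral_ae_eq => //.
    + exact: Radon_Nikodym_integrable.
    + by apply/measurable_EFinP; exact: measurable_normal_pdf.
    + by move=> G _ mG; rewrite -Radon_Nikodym_integral.
  by apply: filterS => x /= h _; rewrite h.
Qed.

(** Completing the square: as a function of [x], the product of the normal
    densities at [y - x] and at [x] is a normal density, up to a factor which
    is the normal density at [y] with the sum of the variances. *)
Lemma normal_pdf_mul r s (x y : R) : r != 0 -> s != 0 ->
  let t := Num.sqrt (r ^+ 2 + s ^+ 2) in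
  normal_pdf x s y * normal_pdf 0 r x =
  normal_pdf 0 t y * normal_pdf (y * (r ^+ 2 / t ^+ 2)) (r * s / t) x.
Proof.
move=> r0 s0 t.
have rs : 0 < r ^+ 2 + s ^+ 2.
  by rewrite ltr_wpDr ?sqr_ge0// exprn_even_gt0.
have t0 : t != 0 by rewrite sqrtr_eq0 -ltNge.
have tt : t ^+ 2 = r ^+ 2 + s ^+ 2 by rewrite sqr_sqrtr// ltW.
rewrite !normal_pdfE ?mulf_neq0 ?invr_eq0// mulrACA [RHS]mulrACA; congr (_ * _).
  rewrite /normal_peak -!invfM -!sqrtrM//; last 2 first.
  - by rewrite mulrn_wge0// mulr_ge0 ?sqr_ge0 ?pi_ge0.
  - by rewrite mulrn_wge0// mulr_ge0 ?sqr_ge0 ?pi_ge0.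
  by congr (Num.sqrt _)^-1; field.
rewrite /normal_fun -!expRD; congr expR; rewrite !exprMn exprVn !tt.
have rs0 : r ^+ 2 + s ^+ 2 != 0 by rewrite gt_eqF.
field.
by rewrite r0 s0 rs0.
Qed.

Lemma measurable_normal_pdf2 s : s != 0 ->
  measurable_fun [set: R * R] (fun z => normal_pdf z.1 s z.2).
Proof.
move=> s0; under eq_fun do rewrite normal_pdfE//.
apply: measurable_funM => //; apply: measurableT_comp => //=.
apply: measurable_funM => //=; apply: measurableT_comp => //=.
apply: measurable_funX => //=; exact: measurable_funB.
Qed.

Lemma normal_prob_le1 m s F : measurable F -> (normal_prob m s F <= 1)%E.
Proof. by move=> mF; exact: (probability_le1 (normal_prob m s)). Qed.

Lemma measurable_normal_prob_mean s F : s != 0 -> measurable F ->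
  measurable_fun setT (fun m : R => normal_prob m s F).
Proof.
move=> s0 mF.
pose g (z : measurableTypeR R * measurableTypeR R) : \bar R :=
  ((normal_pdf z.1 s z.2 * \1_F z.2)%R)%:E.
have mg : measurable_fun setT g.
  apply/measurable_EFinP; apply: measurable_funM.
    exact: measurable_normal_pdf2.
  exact: measurableT_comp (measurable_indic mF) measurable_snd.
have g0 z : (0 <= g z)%E by rewrite lee_fin mulr_ge0 ?normal_pdf_ge0.
have := measurable_fun_fubini_tonelli_F (m2 := mu) g mg g0.
apply: eq_measurable_fun => m _.
rewrite /fubini_F /normal_prob [RHS]integral_mkcond; apply: eq_integral => y _.
rewrite patchE /g/= indicE; case: ifP => _; last by rewrite mulr0.
by rewrite mulr1.
Qed.

(** A mixture of normal laws with a normally distributed mean is normal, and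
    the variances add up. *)
Lemma normal_prob_conv r s F : r != 0 -> s != 0 -> measurable F ->
  (\int[normal_prob 0%R r]_x normal_prob x s F =
   normal_prob 0%R (Num.sqrt (r ^+ 2 + s ^+ 2)%R) F)%E.
Proof.
move=> r0 s0 mF; set t := Num.sqrt _.
pose g (z : measurableTypeR R * measurableTypeR R) : \bar R :=
  ((normal_pdf z.1 s z.2 * normal_pdf 0 r z.1 * \1_F z.2)%R)%:E.
have mg : measurable_fun setT g.
  apply/measurable_EFinP; apply: measurable_funM.
    apply: measurable_funM; first exact: measurable_normal_pdf2.
    exact: measurableT_comp (measurable_normal_pdf _ _) measurable_fst.
  exact: measurableT_comp (measurable_indic mF) measurable_snd.
have g0 z : (0 <= g z)%E.
  by rewrite lee_fin !mulr_ge0 ?normal_pdf_ge0.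
have mpdf m q : measurable_fun [set: R] (EFin \o normal_pdf m q).
  by apply/measurable_EFinP; exact: measurable_normal_pdf.
have lhs x : (normal_prob x s F * (normal_pdf 0%R r x)%:E =
    \int[mu]_y g (x, y))%E.
  rewrite /normal_prob -ge0_integralZr//; last 3 first.
  - by apply/measurable_EFinP/measurable_funTS; exact: measurable_normal_pdf.
  - by move=> y _; rewrite lee_fin normal_pdf_ge0.
  - by rewrite lee_fin normal_pdf_ge0.
  rewrite integral_mkcond; apply: eq_integral => y _.
  rewrite patchE /g/= indicE; case: ifP => _; last by rewrite mulr0.
  by rewrite mulr1.
have rhs y : (\int[mu]_x g (x, y) = (normal_pdf 0%R t y)%:E * (\1_F y)%:E)%E.
  rewrite /g/=.
  transitivity (\int[mu]_x ((normal_pdf 0 t y * \1_F y)%:E *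
      (normal_pdf (y * (r ^+ 2 / t ^+ 2)) (r * s / t) x)%:E))%E.
    by apply: eq_integral => x _; rewrite normal_pdf_mul// mulrAC EFinM.
  rewrite ge0_integralZl//; last 3 first.
  - by apply/measurable_EFinP; exact: measurable_normal_pdf.
  - by move=> x _; rewrite lee_fin normal_pdf_ge0.
  - by rewrite lee_fin mulr_ge0 ?normal_pdf_ge0.
  by rewrite integral_normal_pdf mule1 EFinM.
transitivity (\int[mu]_x \int[mu]_y g (x, y))%E.
  rewrite integral_normal_prob; first by apply: eq_integral => x _; exact: lhs.
  apply: (@le_integrable _ _ _ _ _ _ _ (cst 1%E)) => //=.
  - exact: measurable_normal_prob_mean.
  - by move=> x _; rewrite gee0_abs ?measure_ge0// normr1 normal_prob_le1.
  - exact: finite_measure_integrable_cst.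
rewrite (fubini_tonelli (m1 := mu) (m2 := mu) g mg g0).
rewrite /normal_prob [RHS]integral_mkcond; apply: eq_integral => y _.
rewrite rhs patchE indicE; case: ifP => _; last by rewrite mule0.
by rewrite mule1.
Qed.

End NormalLaw.

(** * Sums of independent normal variables and their tails *)

Section WeightedSums.
Context d (Omega : measurableType d) (R : realType) (P : probability Omega R).
Implicit Types (U V : Omega -> R) (C : set Omega) (F : set R).

Lemma measurable_preimageT (U : Omega -> R) F :
  measurable_fun setT U -> measurable F -> measurable (U @^-1` F).
Proof. by move=> mU mF; rewrite -[X in measurable X]setTI; exact: mU. Qed.

(** Two normal variables that are independent of each other and of the event
    [C]: their combination is normal and independent of [C]. *)
Lemma normal_add_indep U V C (t s a : R) :
  measurable_fun setT U -> measurable_fun setT V -> measurable C ->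
  t != 0 -> s != 0 -> a != 0 ->
  (forall A B, measurable A -> measurable B ->
    P (U @^-1` A `&` V @^-1` B `&` C) =
      (normal_prob 0%R t A * normal_prob 0%R s B * P C)%E) ->
  forall F, measurable F ->
    P ((fun w => U w + a * V w)%R @^-1` F `&` C) =
      (normal_prob 0%R (Num.sqrt (t ^+ 2 + (a * s) ^+ 2)) F * P C)%E.
Proof.
move=> mU mV mC t0 s0 a0 hUV F mF.
have mW : measurable_fun setT (fun w => U w + a * V w).
  by apply: measurable_funD => //; exact: measurable_funM.
have [PC0|PC0] := eqVneq (P C) 0%E.
  rewrite PC0 mule0; apply/eqP; rewrite eq_le measure_ge0 andbT -PC0.
  apply: le_measure; rewrite ?inE//.
  by apply: measurableI => //; exact: measurable_preimageT.
have PCfin : P C \is a fin_num by exact: fin_num_measure.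
pose c : R := fine (P C).
have cE : P C = c%:E by rewrite fineK.
have c0 : 0 < c by rewrite /c fine_gt0// lt0e PC0 measure_ge0 ltey_eq PCfin.
have ci0 : 0 <= c^-1 by rewrite invr_ge0 ltW.
pose UV w : measurableTypeR R * measurableTypeR R := (U w, V w).
have mUV : measurable_fun setT UV by exact: measurable_fun_pair.
(* the joint law of [U] and [V] given [C] is a product measure *)
pose mu' : {measure set (measurableTypeR R * measurableTypeR R) -> \bar R} :=
  mscale (NngNum ci0)
   (measure_function_pushforward__canonical__measure_function_Measure
      (mrestr P mC) mUV).
have mu'E : forall A B : set (measurableTypeR R), measurable A -> measurable B ->
    mu' (A `*` B) = (normal_prob 0%R t A * normal_prob 0%R s B)%E.
  move=> A B mA mB; rewrite /mu'/= /mscale/= /pushforward/= /mrestr.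
  have -> : UV @^-1` (A `*` B) `&` C = U @^-1` A `&` V @^-1` B `&` C by [].
  by rewrite hUV// cE muleC -muleA -EFinM divff ?mule1// gt_eqF.
pose G : set (measurableTypeR R * measurableTypeR R) :=
  [set z | F (z.1 + a * z.2)].
have mG : measurable G.
  rewrite /G -[X in measurable X]setTI.
  have : measurable_fun setT
    (fun z : measurableTypeR R * measurableTypeR R => z.1 + a * z.2).
    by apply: measurable_funD => //; apply: measurable_funM.
  by move=> /(_ measurableT F mF).
have := product_measure_unique mu'E mG.
rewrite {1}/mu'/= /mscale/= /pushforward/= /mrestr.
have -> : UV @^-1` G `&` C = (fun w => U w + a * V w) @^-1` F `&` C by [].
set q := P (_ `&` _) => E1.
have -> : q = ((c^-1)%:E * q * P C)%E.
  by rewrite muleAC cE -EFinM mulVf ?mul1e// gt_eqF.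
rewrite -E1; congr (_ * _)%E.
rewrite -(normal_prob_conv t0 (mulf_neq0 a0 s0) mF).
apply: eq_integral => x _; rewrite [LHS]/comp.
have -> : xsection G x = (fun y => a * y + x) @^-1` F.
  by apply/seteqP; split => y; rewrite /xsection/= inE /G/= addrC.
by rewrite (normal_prob_affine 0 x a0 s0 mF) mulr0 add0r.
Qed.

(** Linear combinations of independent centered normal variables: the
    combination over the indices in [l] is normal, and independent of the
    variables with index in [K], as long as [K] avoids [l]. *)
Lemma normal_sum_indep n (Z : 'I_n -> Omega -> R) (s : R) (a : 'I_n -> R) :
  s != 0 -> (forall i, measurable_fun setT (Z i)) ->
  (forall i, has_normal_law P (Z i) 0 s) -> independent_family P Z ->
  forall l i0, uniq (i0 :: l) -> all (fun i => a i != 0) (i0 :: l) ->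
  forall (K : {set 'I_n}) (E : 'I_n -> set R), (forall i, measurable (E i)) ->
  (forall i, i \in K -> i \notin i0 :: l) ->
  forall F, measurable F ->
  P ((fun w => \sum_(i <- i0 :: l) a i * Z i w) @^-1` F `&`
      \bigcap_(i in [set` K]) (Z i @^-1` E i)) =
  (normal_prob 0%R (s * Num.sqrt (\sum_(i <- i0 :: l) a i ^+ 2)) F *
   P (\bigcap_(i in [set` K]) (Z i @^-1` E i)))%E.
Proof.
move=> s0 mZ nZ iZ l.
have capE (K : {set 'I_n}) (E : 'I_n -> set R) j B : j \notin K ->
    Z j @^-1` B `&` \bigcap_(i in [set` K]) (Z i @^-1` E i) =
    \bigcap_(i in [set` j |: K]%SET)
      (Z i @^-1` (if i == j then B else E i)).
  move=> jK; apply/seteqP; split => w /=.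
    move=> [wB wE] i /=; rewrite inE => /orP[|iK].
      by rewrite inE => /eqP ->; rewrite eqxx.
    by rewrite ifF; [exact: wE|apply: contraNF jK => /eqP <-].
  move=> wE; split.
    by have := wE j; rewrite /= eqxx; apply; rewrite setU11.
  move=> i iK; have := wE i; rewrite /= ifF; last first.
    by apply: contraNF jK => /eqP <-.
  by apply; rewrite inE iK orbT.
have mif E j B : measurable B -> (forall i, measurable (E i)) ->
    forall i : 'I_n, measurable (if i == j then B else E i : set R).
  by move=> mB mE i; case: ifP.
have prodE (K : {set 'I_n}) (E : 'I_n -> set R) j B : measurable B ->
    (forall i, measurable (E i)) -> j \notin K ->
    P (Z j @^-1` B `&` \bigcap_(i in [set` K]) (Z i @^-1` E i)) =
    (normal_prob 0%R s B * P (\bigcap_(i in [set` K]) (Z i @^-1` E i)))%E.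
  move=> mB mE jK; rewrite capE// iZ; last exact: mif.
  rewrite big_setU1//= eqxx iZ//; congr (_ * _)%E; first exact: nZ.
  apply: eq_bigr => i iK; rewrite ifF//.
  by apply: contraNF jK => /eqP <-.
elim: l => [|j1 l IH] i0.
  move=> _ /andP[ai0 _] K E mE KE F mF.
  have -> : (fun w => \sum_(i <- [:: i0]) a i * Z i w) @^-1` F =
      Z i0 @^-1` ((fun x => a i0 * x + 0) @^-1` F).
    by apply/seteqP; split => w /=; rewrite big_seq1 addr0.
  have i0K : i0 \notin K by apply/negP => /KE; rewrite inE eqxx.
  rewrite (prodE K E i0 _ (measurable_preimage_affine _ _ mF) mE i0K).
  rewrite (normal_prob_affine 0 0 ai0 s0 mF) mulr0 addr0 big_seq1; congr (_ * _)%E.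
  rewrite (@eq_normal_prob _ _ (a i0 * s) (s * Num.sqrt (a i0 ^+ 2)))//.
  by rewrite !exprMn sqr_sqrtr ?sqr_ge0// mulrC.
move=> /= /andP[i0l ul] /andP[ai0 al] K E mE KE F mF.
pose U w := \sum_(i <- j1 :: l) a i * Z i w.
have mU : measurable_fun setT U.
  rewrite /U; elim: (j1 :: l) => [|i r IHr].
    by under eq_fun do rewrite big_nil; exact: measurable_cst.
  under eq_fun do rewrite big_cons.
  by apply: measurable_funD => //; exact: measurable_funM.
have i0K : i0 \notin K by apply/negP => /KE; rewrite inE eqxx.
pose C := \bigcap_(i in [set` K]) (Z i @^-1` E i).
have mC : measurable C.
  apply: fin_bigcap_measurable; first exact: finite_finset.
  by move=> i _; exact: measurable_preimageT.
set t := s * Num.sqrt (\sum_(i <- j1 :: l) a i ^+ 2).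
have aj1 : a j1 != 0 by case/andP: al.
have pos : 0 < \sum_(i <- j1 :: l) a i ^+ 2.
  rewrite big_cons ltr_wpDr ?exprn_even_gt0//.
  by apply: sumr_ge0 => i _; exact: sqr_ge0.
have t0 : t != 0 by rewrite mulf_neq0// sqrtr_eq0 -ltNge.
have -> : (fun w => \sum_(i <- [:: i0, j1 & l]) a i * Z i w) =
    (fun w => U w + a i0 * Z i0 w).
  by apply/funext => w; rewrite big_cons addrC.
have rect A B : measurable A -> measurable B ->
    P (U @^-1` A `&` Z i0 @^-1` B `&` C) =
      (normal_prob 0%R t A * normal_prob 0%R s B * P C)%E.
  move=> mA mB; rewrite -setIA (capE _ _ _ _ i0K) (IH j1 ul al _ _ _ _ A mA); last 2 first.
  - exact: mif.
  - move=> i; rewrite inE => /orP[|/KE].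
      by rewrite inE => /eqP ->.
    by rewrite inE negb_or => /andP[].
  by rewrite -(capE _ _ _ _ i0K) (prodE _ _ _ _ mB mE i0K) muleA.
rewrite (normal_add_indep mU (mZ i0) mC t0 s0 ai0 rect mF).
congr (_ * _)%E; rewrite (@eq_normal_prob _ _ _
  (s * Num.sqrt (\sum_(i <- [:: i0, j1 & l]) a i ^+ 2)))//.
rewrite sqr_sqrtr ?addr_ge0 ?sqr_ge0// !exprMn !sqr_sqrtr ?(ltW pos)//.
  by rewrite [in RHS]big_cons; ring.
by rewrite big_cons addr_ge0 ?sqr_ge0 ?(ltW pos).
Qed.

(** A combination of independent centered normal variables with coefficients of
    norm one has the law of each of the variables. *)
Lemma normal_sum n (Z : 'I_n -> Omega -> R) (s : R) (a : 'I_n -> R) F :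
  s != 0 -> (forall i, measurable_fun setT (Z i)) ->
  (forall i, has_normal_law P (Z i) 0 s) -> independent_family P Z ->
  \sum_i a i ^+ 2 = 1 -> measurable F ->
  P ((fun w => \sum_i a i * Z i w) @^-1` F) = normal_prob 0%R s F.
Proof.
move=> s0 mZ nZ iZ a1 mF.
(* null coefficients are dropped: [normal_prob 0 0] is not a point mass *)
pose l := [seq i <- index_enum 'I_n | a i != 0].
have sumE (f : 'I_n -> R) : (forall i, a i = 0 -> f i = 0) ->
    \sum_i f i = \sum_(i <- l) f i.
  move=> f0; rewrite /l big_filter [RHS]big_mkcond/=; apply: eq_bigr => i _.
  by case: eqVneq => //= /f0.
have ul : uniq l by rewrite filter_uniq// index_enum_uniq.
have al : all (fun i => a i != 0) l by exact: filter_all.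
have al1 : \sum_(i <- l) a i ^+ 2 = 1.
  by rewrite -sumE// => i ->; rewrite expr0n.
have -> : (fun w => \sum_i a i * Z i w) = (fun w => \sum_(i <- l) a i * Z i w).
  by apply/funext => w; rewrite sumE// => i ->; rewrite mul0r.
move: ul al al1; case: l {sumE} => [|i0 l] ul al al1.
  by move: al1; rewrite big_nil => /eqP; rewrite eq_sym oner_eq0.
have := @normal_sum_indep _ Z s a s0 mZ nZ iZ l i0 ul al mathcomp.boot.finset.set0
  (fun=> setT) (fun=> measurableT) _ F mF.
rewrite al1 sqrtr1 mulr1.
have -> : \bigcap_(i in [set` (mathcomp.boot.finset.set0 : {set 'I_n})]) (Z i @^-1` setT) = setT.
  by apply/seteqP; split => // w _ i /=; rewrite inE.
rewrite setIT probability_setT mule1; apply.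
by move=> i; rewrite inE.
Qed.

End WeightedSums.

Section Tail.
Variable R : realType.
Local Notation mu := (@lebesgue_measure R).

(** Mills' bound: by the tangent inequality [2 x y - y ^ 2 <= x ^ 2], the normal
    density is below a multiple of the exponential density of rate
    [y / s ^ 2]. *)
Lemma normal_prob_gt_le (s y : R) : s != 0 -> 0 < y ->
  (normal_prob 0%R s `]y, +oo[ <=
    (normal_peak s * (s ^+ 2 / y) * expR (- y ^+ 2 / (s ^+ 2 *+ 2)))%:E)%E.
Proof.
move=> s0 y0.
have ss : 0 < s ^+ 2 by rewrite exprn_even_gt0.
pose r := y / s ^+ 2; have r0 : 0 < r by rewrite divr_gt0.
pose k := normal_peak s * expR (y ^+ 2 / (s ^+ 2 *+ 2)) / r.
have k0 : 0 <= k by rewrite divr_ge0 ?(ltW r0)// mulr_ge0 ?normal_peak_ge0 ?expR_ge0.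
pose f x := r * expR (- r * x).
have fc : continuous f.
  move=> x; apply: cvgM; first exact: cvg_cst.
  apply: (cvg_comp _ expR); last exact: continuous_expR.
  by apply: cvgM; [exact: cvg_cst|exact: cvg_id].
have mf : measurable_fun setT f by exact: continuous_measurable_fun.
have f0 x : 0 <= f x by rewrite mulr_ge0 ?(ltW r0) ?expR_ge0.
have tl : (\int[mu]_(x in `]y, +oo[) (f x)%:E <= (expR (- r * y))%:E)%E.
  apply: (@le_trans _ _ (\int[mu]_(x in `[y, +oo[) (f x)%:E)%E).
    apply: ge0_subset_integral => //=.
    - by apply/measurable_EFinP/measurable_funTS.
    - by move=> x _; rewrite lee_fin.
    - by apply: subset_itvr; rewrite bnd_simp.
  rewrite (@ge0_continuous_FTC2y _ f (fun x => - expR (- r * x)) y 0)//.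
  - by rewrite EFinN oppeK add0e.
  - exact: continuous_subspaceT.
  - rewrite -oppr0; apply: cvgN.
    rewrite (_ : (fun x => expR (- r * x)) =
               (fun z => expR (- z)) \o (fun z => r * z)); last first.
      by apply/funext => x /=; rewrite mulNr.
    apply: (@cvg_comp _ _ _ _ _ _ (pinfty_nbhs R)); last exact: cvgr_expR.
    exact: gt0_cvgMry.
  - apply: cvgN; apply: cvg_at_right_filter.
    apply: (cvg_comp _ expR); last exact: continuous_expR.
    by apply: cvgM; [exact: cvg_cst|exact: cvg_id].
  - move=> x _; rewrite derive1N// derive1_comp// derive1E.
    have /funeqP -> := @derive_expR R.
    by rewrite derive1Ml// derive1_id mulr1 mulrN opprK mulrC.
apply: (@le_trans _ _ (\int[mu]_(x in `]y, +oo[) (k%:E * (f x)%:E))%E).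
  apply: ge0_le_integral => //=.
  - by move=> x _; rewrite lee_fin normal_pdf_ge0.
  - by apply/measurable_EFinP/measurable_funTS; exact: measurable_normal_pdf.
  - by apply: measurable_funeM; apply/measurable_EFinP/measurable_funTS.
  move=> x _; rewrite -EFinM lee_fin normal_pdfE// /normal_fun subr0 /k /f.
  rewrite mulrA divfK ?gt_eqF// -mulrA -expRD ler_wpM2l ?normal_peak_ge0//.
  rewrite ler_expR /r -subr_ge0.
  have -> : y ^+ 2 / (s ^+ 2 *+ 2) + - (y / s ^+ 2) * x - - x ^+ 2 / (s ^+ 2 *+ 2) =
      (y - x) ^+ 2 / (s ^+ 2 *+ 2) by field.
  by rewrite divr_ge0 ?sqr_ge0// mulrn_wge0// ltW.
rewrite ge0_integralZl//=; last 2 first.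
- by apply/measurable_EFinP/measurable_funTS.
- by move=> x _; rewrite lee_fin.
apply: (@le_trans _ _ (k%:E * (expR (- r * y))%:E)%E).
  by apply: lee_wpmul2l; rewrite ?lee_fin.
rewrite -EFinM lee_fin /k.
rewrite le_eqVlt; apply/orP; left; apply/eqP.
have -> : - y ^+ 2 / (s ^+ 2 *+ 2) = y ^+ 2 / (s ^+ 2 *+ 2) + - r * y.
  by rewrite /r; field.
rewrite expRD /r; field.
by rewrite s0 gt_eqF.
Qed.

Lemma normal_prob_norm_gt_le (s y : R) : s != 0 -> 0 < y ->
  (normal_prob 0%R s [set x | (y < `|x|)%R] <=
    (2 * (normal_peak s * (s ^+ 2 / y) * expR (- y ^+ 2 / (s ^+ 2 *+ 2))))%:E)%E.
Proof.
move=> s0 y0.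
have -> : [set x | y < `|x|] =
    `]y, +oo[ `|` (fun x => (-1) * x + 0) @^-1` `]y, +oo[.
  apply/seteqP; split => x /=; rewrite !in_itv/= !andbT mulN1r addr0 lter_normr.
    by move/orP.
  by move/orP.
have mpre := measurable_preimage_affine (-1) 0 (measurable_itv `]y, +oo[).
have n1 : -1 != 0 :> R by rewrite oppr_eq0 oner_eq0.
have sym : normal_prob 0%R s ((fun x => (-1) * x + 0) @^-1` `]y, +oo[) =
    normal_prob 0%R s `]y, +oo[.
  rewrite (normal_prob_affine 0 0 n1 s0)// mulr0 addr0.
  by rewrite (@eq_normal_prob _ _ (-1 * s) s)// mulN1r sqrrN.
apply: (le_trans (measureU2 (normal_prob 0 s) _ mpre)) => //.
rewrite mulr2n mulrDl mul1r EFinD; apply: leeD; first exact: normal_prob_gt_le.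
by rewrite [leLHS]sym; exact: normal_prob_gt_le.
Qed.

End Tail.

(** * The functional linear model *)

Section Integrals.
Variable R : realType.
Implicit Types f g : R -> R.

Lemma integrable01Z f a : integrable01 f -> integrable01 (fun s => f s * a).
Proof. by move=> intf; exact: (integrableZr _ a intf). Qed.

Lemma integrable01_sum (I : Type) (r : seq I) (F : I -> R -> R) :
  (forall k, integrable01 (F k)) -> integrable01 (fun s => \sum_(k <- r) F k s).
Proof.
move=> intF; rewrite /integrable01.
have -> : EFin \o (fun s => \sum_(k <- r) F k s) =
    (fun s => \sum_(k <- r) (EFin \o F k) s)%E.
  by apply/funext => s /=; rewrite sumEFin.
by apply: integrable_sum => // k _; exact: intF.
Qed.

Lemma int01Z f a : integrable01 f -> int01 (fun s => f s * a) = int01 f * a.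
Proof. by move=> intf; rewrite /int01 RintegralZr. Qed.

Lemma int01B f g : integrable01 f -> integrable01 g ->
  int01 (fun s => f s - g s) = int01 f - int01 g.
Proof. by move=> intf intg; rewrite /int01 RintegralB. Qed.

Lemma int01_sum (I : Type) (r : seq I) (F : I -> R -> R) :
  (forall k, integrable01 (F k)) ->
  int01 (fun s => \sum_(k <- r) F k s) = \sum_(k <- r) int01 (F k).
Proof.
move=> intF; elim: r => [|k r IH].
  rewrite big_nil /int01; under eq_Rintegral do rewrite big_nil.
  by rewrite Rintegral_cst// mul0r.
rewrite big_cons -IH /int01; under eq_Rintegral do rewrite big_cons.
by rewrite RintegralD//; [exact: intF|exact: integrable01_sum].
Qed.

End Integrals.

Section Deterministic.
Variables (R : realType) (n p : nat) (beta : R -> R) (X : 'I_n -> R -> R).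
Variables (B : R -> 'cV[R]_p) (A : 'M[R]_p) (eta : 'cV[R]_p).
Hypothesis hA : A \in unitmx.
Hypothesis hIntBeta : forall i, integrable01 (fun s => X i s * beta s).
Hypothesis hIntB : forall i j, integrable01 (fun s => X i s * B s j 0).
Let V := Vmx X B A.
Hypothesis hCols : forall j, col j V != 0.

(** The coefficients with respect to the normalized columns of [V] of the
    combination of the columns of [V] with coefficients [g]. *)
Definition std_coef (g : 'cV[R]_p) : 'cV[R]_p :=
  \col_j (g j 0 * l2norm (col j V)).

Lemma mul_basisE i (c : 'cV[R]_p) :
  (fun s => X i s * ((B s)^T *m c) 0 0) =
  (fun s => \sum_k (X i s * B s k 0) * c k 0).
Proof.
apply/funext => s; rewrite mxE mulr_sumr; apply: eq_bigr => k _.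
by rewrite mxE mulrA.
Qed.

Lemma int01_basis i (c : 'cV[R]_p) :
  int01 (fun s => X i s * ((B s)^T *m c) 0 0) =
  \sum_k int01 (fun s => X i s * B s k 0) * c k 0.
Proof.
rewrite mul_basisE int01_sum; first by apply: eq_bigr => k _; rewrite int01Z.
by move=> k; exact: integrable01Z.
Qed.

Lemma integrable01_basis i (c : 'cV[R]_p) :
  integrable01 (fun s => X i s * ((B s)^T *m c) 0 0).
Proof.
by rewrite mul_basisE; apply: integrable01_sum => k; exact: integrable01Z.
Qed.

Lemma VmxE i j : V i j = int01 (fun s => X i s * ((B s)^T *m col j (invmx A)) 0 0).
Proof.
by rewrite int01_basis mxE; apply: eq_bigr => k _; rewrite !mxE.
Qed.

Lemma mul_standardize (g : 'cV[R]_p) : standardize V *m std_coef g = V *m g.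
Proof.
apply/matrixP => i j; rewrite !mxE; apply: eq_bigr => k _.
rewrite ord1 !mxE -mulrA [_^-1 * _]mulrCA mulVf ?mulr1// gt_eqF//.
exact: l2norm_gt0.
Qed.

(** At the true coefficients, the residuals are the errors increased by the
    integrals of the predictors against the approximation error. *)
Lemma residualE (e : 'cV[R]_n) :
  response X beta e - standardize V *m std_coef (A *m eta) =
  \col_i (e i 0 + int01 (fun s => X i s * approx_err beta B eta s)).
Proof.
rewrite mul_standardize /V /Vmx mulmxA mulmxKV//.
apply/matrixP => i j; rewrite ord1 !mxE.
have -> : (fun s => X i s * approx_err beta B eta s) =
    (fun s => X i s * beta s - X i s * ((B s)^T *m eta) 0 0).
  by apply/funext => s; rewrite -mulrBr.
rewrite int01B//; last exact: integrable01_basis.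
rewrite int01_basis addrAC [in RHS]addrC; congr (_ - _ + _).
by apply: eq_bigr => k _; rewrite mxE.
Qed.

Lemma sum_sqr_col_standardize j : \sum_i (standardize V i j) ^+ 2 = 1.
Proof.
have l0 := l2norm_gt0 (hCols j).
transitivity ((\sum_i V i j ^+ 2) / l2norm (col j V) ^+ 2).
  by rewrite mulr_suml; apply: eq_bigr => i _; rewrite mxE exprMn exprVn.
rewrite sqr_l2norm -[X in X / _](_ : dotp (col j V) (col j V) = _).
  by rewrite divff// -sqr_l2norm sqrf_eq0 gt_eqF.
by apply: eq_bigr => i _; rewrite mxE expr2.
Qed.

(** The estimation error at a point, in terms of that of the coefficients. *)
Lemma flirti_error_le (g : 'cV[R]_p) s : (0 < n)%N ->
  `|flirti B A V g s - beta s| <=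
    (Num.sqrt n%:R)^-1 * alpha X B A s * l2norm (g - std_coef (A *m eta)) +
    `|approx_err beta B eta s|.
Proof.
move=> n0; pose c j := ((B s)^T *m col j (invmx A)) 0 0.
have cE (v : 'cV[R]_p) : ((B s)^T *m (invmx A *m v)) 0 0 = \sum_j c j * v j 0.
  rewrite mulmxA mxE; apply: eq_bigr => j _; congr (_ * _).
  by rewrite /c !mxE; apply: eq_bigr => k _; rewrite !mxE.
have nz j : l2norm (col j V) != 0 by rewrite gt_eqF// l2norm_gt0.
have -> : flirti B A V g s - beta s =
    \sum_j (c j / l2norm (col j V)) * (g - std_coef (A *m eta)) j 0
    - approx_err beta B eta s.
  rewrite /flirti cE /approx_err opprB addrA; congr (_ - _).
  have -> : ((B s)^T *m eta) 0 0 = \sum_j c j * (A *m eta) j 0.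
    by rewrite -cE (mulmxA (invmx A)) mulVmx// mul1mx.
  rewrite addrC -big_split/=; apply: eq_bigr => j _; rewrite !mxE.
  by field; exact: nz.
rewrite (le_trans (ler_normB _ _))// lerD2r.
apply: (le_trans (normr_sum_mul_le _ _ _)).
rewrite ler_wpM2r ?l2norm_ge0//.
rewrite /alpha -sqrtrV ?ler0n// -sqrtrM ?invr_ge0 ?ler0n//.
rewrite ler_wsqrtr// mulr_sumr; apply: ler_sum => j _.
have -> : \sum_i int01 (fun s0 => X i s0 * ((B s0)^T *m col j (invmx A)) 0 0) ^+ 2 =
    l2norm (col j V) ^+ 2.
  rewrite sqr_l2norm; apply: eq_bigr => i _.
  by rewrite mxE -VmxE expr2.
rewrite -/(c j) le_eqVlt; apply/orP; left; apply/eqP.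
by field; rewrite nz pnatr_eq0 -lt0n n0.
Qed.

End Deterministic.

(** * The noise event and the rates *)

Section NoiseEvent.
Context d (Omega : measurableType d) (R : realType) (P : probability Omega R).

(** The event that every column of [W] has an inner product of absolute value at
    most [y] with the noise [Z]. *)
Definition small_noise n p (W : 'M[R]_(n, p)) (Z : 'I_n -> Omega -> R) (y : R) :
    set Omega :=
  \bigcap_(j in [set: 'I_p])
    ((fun w => \sum_i W i j * Z i w) @^-1` [set x | `|x| <= y]).

Lemma measurable_norm_le (y : R) : measurable [set x : R | `|x| <= y].
Proof.
rewrite (_ : [set x | _] = `[- y, y]%classic); first exact: measurable_itv.
by apply/seteqP; split => x /=; rewrite in_itv/= ler_norml.
Qed.

Lemma measurable_lincomb n (a : 'I_n -> R) (Z : 'I_n -> Omega -> R) :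
  (forall i, measurable_fun setT (Z i)) ->
  measurable_fun setT (fun w => \sum_i a i * Z i w).
Proof.
move=> mZ; elim: (index_enum _) => [|i r IHr].
  by under eq_fun do rewrite big_nil; exact: measurable_cst.
under eq_fun do rewrite big_cons.
by apply: measurable_funD => //; exact: measurable_funM.
Qed.

Lemma measurable_small_noise n p (W : 'M[R]_(n, p)) Z y :
  (forall i, measurable_fun setT (Z i)) -> measurable (small_noise W Z y).
Proof.
move=> mZ; apply: fin_bigcap_measurable => [|j _].
  exact: finite_finset.
apply: measurable_preimageT; last exact: measurable_norm_le.
exact: measurable_lincomb.
Qed.

Lemma measure_bigsetU_le (I : Type) (r : seq I) (D : I -> set Omega) :
  (forall i, measurable (D i)) ->
  (P (\big[setU/set0]_(i <- r) D i) <= \sum_(i <- r) P (D i))%E.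
Proof.
move=> mD; elim: r => [|i r IH]; first by rewrite !big_nil measure0.
rewrite !big_cons (le_trans (measureU2 _ _ _))//.
  exact: bigsetU_measurable.
by rewrite leeD2l.
Qed.

Lemma small_noise_ge n p (W : 'M[R]_(n, p)) (Z : 'I_n -> Omega -> R) (s y : R) :
  s != 0 -> 0 < y -> (forall i, measurable_fun setT (Z i)) ->
  (forall i, has_normal_law P (Z i) 0 s) -> independent_family P Z ->
  (forall j, \sum_i W i j ^+ 2 = 1) ->
  ((1 - p%:R * (2 * (normal_peak s * (s ^+ 2 / y) *
      expR (- y ^+ 2 / (s ^+ 2 *+ 2)))))%:E <= P (small_noise W Z y))%E.
Proof.
move=> s0 y0 mZ nZ iZ W1; set q := 2 * _.
have mG : measurable (small_noise W Z y) by exact: measurable_small_noise.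
pose D j := (fun w => \sum_i W i j * Z i w) @^-1` [set x | y < `|x|].
have mgt : measurable [set x : R | y < `|x|].
  rewrite (_ : [set x | _] = ~` [set x | `|x| <= y]).
    by apply: measurableC; exact: measurable_norm_le.
  by apply/seteqP; split => x /=; rewrite ltNge => /negP.
have mD j : measurable (D j).
  by apply: measurable_preimageT => //; exact: measurable_lincomb.
have GC : ~` small_noise W Z y = \big[setU/set0]_(j <- index_enum 'I_p) D j.
  rewrite -bigcup_seq setC_bigcap; apply/seteqP; split => w [j _ /=].
    by move=> /negP; rewrite -ltNge => jD; exists j => //=; rewrite mem_index_enum.
  by move=> jD; exists j => //=; apply/negP; rewrite -ltNge.
have le1 : (P (~` small_noise W Z y) <= (p%:R * q)%:E)%E.
  rewrite GC (le_trans (measure_bigsetU_le _ mD))//.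
  apply: (@le_trans _ _ (\sum_(j < p) q%:E)%E).
    apply: lee_sum => j _; rewrite /D (normal_sum s0 mZ nZ iZ (W1 j) mgt).
    exact: normal_prob_norm_gt_le.
  by rewrite sumEFin lee_fin sumr_const card_ord mulr_natl.
move: le1; rewrite probability_setC// -[P (small_noise _ _ _)]fineK ?fin_num_measure//.
by rewrite -EFinB !lee_fin; lra.
Qed.

End NoiseEvent.

Section Rates.
Variable R : realType.

(** The two summands serve the two signs of [b]. *)
Lemma powR_le_bounds (a c q b : R) : 0 < a -> a <= q -> q <= c ->
  q `^ b <= a `^ b + c `^ b.
Proof.
move=> a0 aq qc; have q0 : 0 < q by exact: lt_le_trans aq.
have c0 : 0 < c by exact: lt_le_trans qc.
have [b0|b0] := leP 0 b.
  apply: (@le_trans _ _ (c `^ b)); last by rewrite lerDr powR_ge0.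
  by apply: ge0_ler_powR; rewrite ?nnegrE// ltW.
apply: (@le_trans _ _ (a `^ b)); last by rewrite lerDl powR_ge0.
rewrite -[b]opprK !(powRN _ (- b)) lef_pV2 ?posrE ?powR_gt0//.
by apply: ge0_ler_powR; rewrite ?nnegrE ?oppr_ge0// ltW.
Qed.

Lemma near_le_comp (pn : nat -> nat) (x : R) :
  pn n @[n --> \oo] --> \oo -> \forall n \near \oo, x <= (pn n)%:R.
Proof. by move=> poo; exact: poo (nbhs_infty_ger x). Qed.

(** Rate of the error bound, with [M p ^ b] for [alpha], [C sqrt (ln p)] for the
    norm of the error in the coefficients, and [H / p ^ m] for the
    approximation error. If [m + b] were zero, [p] would be bounded. *)
Lemma rate_le (pn : nat -> nat) (m b M H C : R) :
  0 < m -> 0 <= M -> 0 <= H -> 0 <= C ->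
  pn n @[n --> \oo] --> \oo ->
  ((pn n)%:R / n%:R : R) @[n --> \oo] --> (0 : R) ->
  grows_at_rate pn (fun n => n%:R `^ (2 * m + 2 * b)^-1) ->
  exists K : R, \forall n \near \oo,
    (Num.sqrt n%:R)^-1 * (M * (pn n)%:R `^ b) * (C * Num.sqrt (ln (pn n)%:R)) +
      H / (pn n)%:R `^ m <=
    K * (Num.sqrt (ln n%:R) / n%:R `^ (2^-1 * (m / (m + b)))).
Proof.
move=> m0 M0 H0 C0 poo pn0 [a [c [a0 hac]]].
have mb0 : m + b != 0.
  apply/eqP => mb.
  have e0 : (2 * m + 2 * b)^-1 = 0 by rewrite -mulrDr mb mulr0 invr0.
  have [N _ hN] := near_le_comp (c + 1) poo.
  have := hN N.+1 (leqnSn N); have [_] := hac N.+1 isT.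
  by rewrite e0 powRr0 divr1; lra.
pose e := (2 * m + 2 * b)^-1; pose dl := 2^-1 * (m / (m + b)).
exists (M * (a `^ b + c `^ b) * C + H / a `^ m).
have pn1 : \forall n \near \oo, (pn n)%:R / n%:R <= 1 :> R.
  have /cvgrPdist_le /(_ 1 ltr01) := pn0.
  by apply: filterS => n; rewrite sub0r normrN ger0_norm// divr_ge0.
near=> n.
have n_e : expR 1 <= n%:R :> R by near: n; exact: nbhs_infty_ger.
have p1 : 1 <= (pn n)%:R :> R by near: n; exact: near_le_comp.
have pn_le1 : (pn n)%:R / n%:R <= 1 :> R by near: n.
have nr0 : 0 < n%:R :> R by exact: lt_le_trans (expR_gt0 1) n_e.
have n0 : (0 < n)%N by rewrite -(ltr0n R).
have p0 : 0 < (pn n)%:R :> R by exact: lt_le_trans p1.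
have pn_le : (pn n)%:R <= n%:R :> R by rewrite -(mul1r n%:R) -ler_pdivrMr.
have [aq qc] := hac n n0.
rewrite -/e in aq qc; set r := n%:R `^ e in aq qc.
have r0 : 0 < r by rewrite powR_gt0.
set q := (pn n)%:R / r in aq qc.
have q0 : 0 < q by exact: lt_le_trans aq.
have pE : (pn n)%:R = q * r by rewrite /q divfK// gt_eqF.
have ln1 : 1 <= ln n%:R :> R.
  have : ln (expR 1) <= ln n%:R :> R by rewrite ler_ln ?posrE ?expR_gt0.
  by rewrite expRK.
have sl1 : 1 <= Num.sqrt (ln n%:R) :> R.
  by have := ler_wsqrtr ln1; rewrite sqrtr1.
have lnpn : Num.sqrt (ln (pn n)%:R) <= Num.sqrt (ln n%:R) :> R.
  by rewrite ler_wsqrtr// ler_ln ?posrE.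
have mb2 : 2 * m + 2 * b != 0 by rewrite -mulrDr mulf_neq0.
have e1 : (Num.sqrt n%:R)^-1 * r `^ b = (n%:R `^ dl)^-1.
  rewrite -powR12_sqrt ?ltW// -!powRN /r -powRrM -powRD; last first.
    by apply/implyP => _; rewrite gt_eqF.
  by congr (_ `^ _); rewrite /e /dl; field; rewrite mb0 mb2.
have e2 : r `^ m = n%:R `^ dl.
  rewrite /r -powRrM; congr (_ `^ _); rewrite /e /dl; field.
  by rewrite mb0 mb2.
have nd0 : 0 < n%:R `^ dl by rewrite powR_gt0.
rewrite -/dl mulrDl; apply: lerD.
  rewrite pE (powRM _ (ltW q0) (ltW r0)) -pE.
  have -> : (Num.sqrt n%:R)^-1 * (M * (q `^ b * r `^ b)) *
      (C * Num.sqrt (ln (pn n)%:R)) =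
      (M * q `^ b * C) * (((Num.sqrt n%:R)^-1 * r `^ b) * Num.sqrt (ln (pn n)%:R)).
    by ring.
  rewrite e1 [_^-1 * _]mulrC; apply: ler_pM.
  - by rewrite !mulr_ge0 ?powR_ge0.
  - by rewrite divr_ge0 ?sqrtr_ge0 ?ltW.
  - by rewrite ler_wpM2r// ler_wpM2l// powR_le_bounds.
  - by rewrite ler_wpM2r ?invr_ge0 ?(ltW nd0).
rewrite pE (powRM _ (ltW q0) (ltW r0)) e2 invfM mulrA; apply: ler_pM.
- by rewrite divr_ge0 ?powR_ge0.
- by rewrite invr_ge0 ltW.
- rewrite ler_wpM2l// lef_pV2 ?posrE ?powR_gt0//.
  by apply: ge0_ler_powR; rewrite ?nnegrE// ltW.
- by rewrite ler_peMl ?invr_ge0 ?(ltW nd0).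
Unshelve. all: by end_near. Qed.

End Rates.

(** * Rate of convergence of the estimate *)

(** The union bound over [p] tails at the level [lam] vanishes as [p] grows. For
    [phi = 0] this is due to the factor [1 / lam] in Mills' bound. *)
Lemma noise_level_tail (R : realType) (sigma phi e : R) :
  0 < sigma -> 0 <= phi -> 0 < e ->
  exists x0 : R, forall p : nat, x0 <= p%:R ->
    let lam := sigma * Num.sqrt (2 * (1 + phi) * ln p%:R) in
    0 < lam /\ p%:R * (2 * (normal_peak sigma * (sigma ^+ 2 / lam) *
      expR (- lam ^+ 2 / (sigma ^+ 2 *+ 2)))) <= e.
Proof.
move=> s0 phi0 e0; pose c := 2 * (normal_peak sigma * sigma ^+ 2).
have sn0 : sigma != 0 by rewrite gt_eqF.
have c0 : 0 < c by rewrite !mulr_gt0 ?normal_peak_gt0 ?exprn_gt0.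
pose t := c / e / sigma.
have t0 : 0 < t by rewrite !divr_gt0.
(* for larger [p], [lam] is at least [c / e] *)
exists (expR (t ^+ 2)) => p xp lam.
have p0 : 0 < p%:R :> R by exact: lt_le_trans (expR_gt0 _) xp.
have lnp : t ^+ 2 <= ln p%:R.
  have : ln (expR (t ^+ 2)) <= ln p%:R by rewrite ler_ln ?posrE ?expR_gt0.
  by rewrite expRK.
have lnp0 : 0 < ln p%:R :> R by rewrite (lt_le_trans _ lnp)// exprn_gt0.
have arg0 : 0 <= 2 * (1 + phi) * ln p%:R by rewrite !mulr_ge0 ?ltW//; lra.
have t_le : t <= Num.sqrt (2 * (1 + phi) * ln p%:R).
  rewrite -(ger0_norm (ltW t0)) -sqrtr_sqr ler_wsqrtr//.
  by nra.
have lam_ge : c / e <= lam.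
  by rewrite /lam [leRHS]mulrC -ler_pdivrMr.
have lam0 : 0 < lam by rewrite (lt_le_trans _ lam_ge)// divr_gt0.
split => //.
have -> : - lam ^+ 2 / (sigma ^+ 2 *+ 2) = - ((1 + phi) * ln p%:R).
  by rewrite /lam exprMn sqr_sqrtr//; field.
(* the exponential cancels the number [p] of tails *)
have exp_le : expR (- ((1 + phi) * ln p%:R)) <= p%:R^-1.
  rewrite -[X in _ <= X^-1](@lnK R p%:R) ?posrE// -expRN ler_expR lerN2.
  by nra.
apply: (@le_trans _ _ (p%:R * (2 * (normal_peak sigma * (sigma ^+ 2 / lam) * p%:R^-1)))).
  have k0 : 0 <= normal_peak sigma * (sigma ^+ 2 / lam).
    by rewrite mulr_ge0 ?normal_peak_ge0// divr_ge0 ?sqr_ge0 ?(ltW lam0).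
  by rewrite ler_wpM2l// ler_wpM2l// ler_wpM2l.
have -> : p%:R * (2 * (normal_peak sigma * (sigma ^+ 2 / lam) * p%:R^-1)) = c / lam.
  by rewrite /c; field; rewrite !gt_eqF.
by rewrite ler_pdivrMr// mulrC -ler_pdivrMr.
Qed.

Lemma measure_setD_null d (T : measurableType d) (R : realType)
    (P : probability T R) (A N : set T) :
  measurable A -> measurable N -> P N = 0%E -> P (A `\` N) = P A.
Proof.
move=> mA mN PN; rewrite (measureDI P mA mN) [X in (_ + X)%E](_ : _ = 0%E) ?adde0//.
apply/eqP; rewrite eq_le measure_ge0 andbT -PN.
by apply: le_measure; rewrite ?inE//; exact: measurableI.
Qed.

Lemma cvg_prob1 d (T : measurableType d) (R : realType) (P : probability T R)
    (E : nat -> set T) :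
  (forall n, measurable (E n)) ->
  (forall e : R, 0 < e -> \forall n \near \oo, ((1 - e)%:E <= P (E n))%E) ->
  P (E n) @[n --> \oo] --> 1%E.
Proof.
move=> mE hE; apply/fine_cvgP; split.
  by near=> n; rewrite fin_num_measure.
apply/cvgrPdist_le => e e0; have := hE e e0.
apply: filterS => n /=; have := probability_le1 P (mE n).
rewrite -[P (E n)]fineK ?fin_num_measure// !lee_fin => h1 h2.
by rewrite ger0_norm ?subr_ge0//; lra.
Unshelve. all: by end_near. Qed.

Lemma sup01_ge (R : realType) (f : R -> R) (x : \bar R) s :
  s \in `[0, 1] -> (sup01 f <= x)%E -> ((f s)%:E <= x)%E.
Proof.
move=> s01; apply: le_trans; apply: ereal_sup_ubound; exists s => //.
Qed.

Theorem theorem6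
  (R : realType) (d : measure_display) (Omega : measurableType d)
  (P : probability Omega R)
  (* coefficient function, predictors and errors (for each sample size n) *)
  (beta : R -> R)
  (X : forall n : nat, 'I_n -> R -> R)
  (eps : forall n : nat, 'I_n -> {RV P >-> R})
  (* basis, its coefficients, the matrix A and the sparsity bound, for each p *)
  (B : forall p : nat, R -> 'cV[R]_p)
  (eta : forall p : nat, 'cV[R]_p)
  (A : forall p : nat, 'M[R]_p)
  (Sp : nat -> nat)
  (pn : nat -> nat)
  (S : nat) (m t bt c sigma2 phi : R)
  (* whether the lasso or the Dantzig selector is used, and the solution *)
  (use_lasso : bool)
  (ghat : forall n : nat, Omega -> 'cV[R]_(pn n)) :
  let gamma p := A p *m eta p in
  let epsstar n i w :=
    eps n i w + int01 (fun s => X n i s * approx_err beta (B (pn n)) (eta (pn n)) s) in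
  let V n := Vmx (X n) (B (pn n)) (A (pn n)) in
  let Y n w := response (X n) beta (\col_i eps n i w) in
  let lam n := sigma2 * Num.sqrt (2 * (1 + phi) * ln (pn n)%:R) in
  let betahat n w := flirti (B (pn n)) (A (pn n)) (V n) (ghat n w) in
  forall
  (* standing assumptions *)
  (hBasis : forall p, basis01 (B p))
  (hA : forall p, A p \in unitmx)
  (hIntBeta : forall n i, integrable01 (fun s => X n i s * beta s))
  (hIntB : forall n i p j, integrable01 (fun s => X n i s * B p s j 0))
  (hCols : forall n, (0 < n)%N -> forall j, col j (V n) != 0)
  (ht : t \in `[0, 1])
  (hm : 0 < m) (hsigma2 : 0 < sigma2) (hphi : 0 <= phi)
  (hSparse : forall p, (0 < p)%N -> (nnonzero (gamma p) <= Sp p)%N)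
  (* (A-1) *)
  (A1 : forall p, (0 < p)%N -> (Sp p <= S)%N)
  (* (A-2) *)
  (A2 : exists H : R, forall p, (0 < p)%N ->
     (omega beta (B p) (eta p) <= (H / p%:R `^ m)%:E)%E)
  (* (A-3) *)
  (A3 : exists M : R, forall n p, (0 < n)%N -> (0 < p)%N ->
     p%:R `^ (- bt) * alpha (X n) (B p) (A p) t <= M)
  (* (A-4) *)
  (A4 : exists M : R, forall n p, (0 < n)%N -> (0 < p)%N ->
     ((p%:R `^ (- c))%:E * sup01 (alpha (X n) (B p) (A p)) <= M%:E)%E)
  (* (A-6) *)
  (hp_oo : pn n @[n --> \oo] --> \oo)
  (hp_n : ((pn n)%:R / n%:R : R) @[n --> \oo] --> (0 : R))
  (A6 : exists kappa : R, 0 < kappa /\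
     \forall n \near \oo,
       delta (V n) (2 * S)%N + theta (V n) S (2 * S)%N <= 1 - kappa)
  (* Gaussian errors *)
  (hIndep : forall n, (0 < n)%N -> independent_family P (epsstar n))
  (hNormal : forall n i, has_normal_law P (epsstar n i) 0 sigma2)
  (hRestr : forall n, (0 < n)%N ->
     delta (V n) (2 * Sp (pn n))%N + theta (V n) (Sp (pn n)) (2 * Sp (pn n))%N < 1)
  (* FLiRTI estimates *)
  (hSol : forall n, (0 < n)%N -> forall w,
     if use_lasso
     then lasso_solution (standardize (V n)) (Y n w) (lam n) (ghat n w)
     else dantzig_solution (standardize (V n)) (Y n w) (lam n) (ghat n w))
  (hLasso : use_lasso -> forall n, (0 < n)%N ->
     {ae P, forall w, lasso_condition (standardize (V n)) (ghat n w)}),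
  (grows_at_rate pn (fun n => n%:R `^ (2 * m + 2 * bt)^-1) ->
     exists K : R, with_prob_to_one P (fun n => [set w |
       `|betahat n w t - beta t| <=
         K * (Num.sqrt (ln n%:R) / n%:R `^ (2^-1 * (m / (m + bt))))]))
  /\
  (grows_at_rate pn (fun n => n%:R `^ (2 * m + 2 * c)^-1) ->
     exists K : R, with_prob_to_one P (fun n => [set w |
       (sup01 (fun s => `|betahat n w s - beta s|)%R <=
         (K * (Num.sqrt (ln n%:R) / n%:R `^ (2^-1 * (m / (m + c)))))%:E)%E])).
Proof.
move=> gamma epsstar V Y lam betahat hBasis hA hIntBeta hIntB hCols ht hm hsigma2
  hphi hSparse A1 A2 A3 A4 hp_oo hp_n A6 hIndep hNormal hRestr hSol hLasso.
have [H hH] := A2; have [kappa [kappa0 hkappa]] := A6.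
have lam0 n : 0 <= lam n by rewrite mulr_ge0 ?sqrtr_ge0// ltW.
have sn0 : sigma2 != 0 by rewrite gt_eqF.
have meps n i : measurable_fun setT (epsstar n i).
  by apply: measurable_funD.
(* outside of a null set, the estimate solves the Dantzig problem, also when it
   is a lasso solution *)
have /choice[N hN] : forall n, exists Nn : set Omega, [/\ measurable Nn,
    P Nn = 0%E & (0 < n)%N -> forall w, ~ Nn w ->
      dantzig_solution (standardize (V n)) (Y n w) (lam n) (ghat n w)].
  move=> n.
  have [n0|n0] := posnP n.
    by exists set0; split => //; rewrite ?measure0// n0.
  have sol := hSol n n0; have [ul|/negbTE ul] := boolP use_lasso; last first.
    by exists set0; rewrite ul in sol; split => //; rewrite measure0.
  have [Nn [mNn PNn sub]] := hLasso ul n n0; rewrite ul in sol.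
  exists Nn; split => // _ w Nw; apply: lasso_dantzig => //.
  by apply: contrapT => nc; exact/Nw/sub.
(* the norm of the error in the coefficients is at most [C * sqrt (ln p)] *)
pose C := 16 * Num.sqrt S%:R * (sigma2 * Num.sqrt (2 * (1 + phi))) / kappa.
have C0 : 0 <= C.
  by rewrite divr_ge0 ?(ltW kappa0)// !mulr_ge0 ?sqrtr_ge0 ?(ltW hsigma2).
(* a single event serves all the points [s] where [p ^ (- b) * alpha s <= M] *)
have core (b M : R) : grows_at_rate pn (fun n => n%:R `^ (2 * m + 2 * b)^-1) ->
    exists K : R, with_prob_to_one P (fun n => [set w | forall s, s \in `[0, 1] ->
      ((0 < n)%N -> (0 < pn n)%N ->
        (pn n)%:R `^ (- b) * alpha (X n) (B (pn n)) (A (pn n)) s <= M) ->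
      `|betahat n w s - beta s| <=
        K * (Num.sqrt (ln n%:R) / n%:R `^ (2^-1 * (m / (m + b))))]).
  move=> rate.
  have [K [N1 _ hN1]] := rate_le hm (normr_ge0 M) (normr_ge0 H) C0 hp_oo hp_n rate.
  have [N2 _ hN2] := near_le_comp (1 : R) hp_oo.
  have [N3 _ hN3] := hkappa.
  pose G n := small_noise (standardize (V n)) (epsstar n) (lam n).
  pose good n := [&& (0 < n)%N, (N1 <= n)%N, (N2 <= n)%N & (N3 <= n)%N].
  have mG n : measurable (G n) by exact: measurable_small_noise.
  (* only large [n] matter for the limit *)
  pose E n := if good n then G n `\` N n else set0.
  have mE n : measurable (E n).
    by rewrite /E; case: ifP => // _; apply: measurableD => //; case: (hN n).
  exists K, E; split => //; split.
    move=> n w; rewrite /E; case: ifP => // /and4P[n0 n1 n2 n3] [Gw Nw] s s01 hM.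
    have p1 : 1 <= (pn n)%:R :> R by exact: hN2.
    have p0 : (0 < pn n)%N by rewrite -(ltr0n R) (lt_le_trans _ p1).
    have pr0 : 0 < (pn n)%:R :> R by rewrite ltr0n.
    have [_ _ /(_ n0 w Nw) sol] := hN n.
    have cols := hCols n n0; have intB i := hIntB n i (pn n).
    pose g := std_coef (X n) (B (pn n)) (A (pn n)) (A (pn n) *m eta (pn n)).
    have gsparse : (nnonzero g <= S)%N.
      rewrite (leq_trans _ (A1 _ p0))// (leq_trans _ (hSparse _ p0))//.
      rewrite /nnonzero subset_leq_card//; apply/fintype.subsetP => j.
      by rewrite !inE mxE; apply: contra => /eqP ->; rewrite mul0r.
    have feas : dantzig_feasible (standardize (V n)) (Y n w) (lam n) g.
      move=> j; rewrite (residualE _ (hA (pn n)) (hIntBeta n) intB cols).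
      rewrite trmx_mulE; have := Gw j I; congr (`|_| <= _).
      by apply: eq_bigr => i _; rewrite !mxE.
    have l2 := dantzig_l2norm_le (lam0 n) kappa0 (hN3 n n3) gsparse feas sol.
    have l2' : l2norm (ghat n w - g) <= C * Num.sqrt (ln (pn n)%:R).
      rewrite (le_trans l2)// /lam /C sqrtrM; last by rewrite mulr_ge0//; lra.
      by rewrite le_eqVlt; apply/orP; left; apply/eqP; ring.
    apply: le_trans (hN1 n n1).
    apply: (le_trans
      (flirti_error_le beta (eta (pn n)) (hA (pn n)) intB cols (ghat n w) s n0)).
    apply: lerD; last first.
      have := le_trans (sup01_ge s01 (lexx _)) (hH _ p0).
      rewrite lee_fin => /le_trans; apply.
      by rewrite ler_wpM2r ?invr_ge0 ?powR_ge0// ler_norm.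
    apply: ler_pM => //.
    + by rewrite mulr_ge0 ?invr_ge0 ?sqrtr_ge0.
    + exact: l2norm_ge0.
    rewrite ler_wpM2l ?invr_ge0 ?sqrtr_ge0//.
    rewrite -ler_pdivrMr ?powR_gt0// -powRN mulrC.
    by rewrite (le_trans (hM n0 p0))// ler_norm.
  apply: cvg_prob1 => // e e0.
  have [x0 hx0] := noise_level_tail hsigma2 hphi e0.
  have [N4 _ hN4] := near_le_comp x0 hp_oo.
  exists (maxn 1 (maxn N1 (maxn N2 (maxn N3 N4)))) => // n /=.
  rewrite !geq_max => /and5P[n0 n1 n2 n3 n4].
  have [lamp tail] := hx0 _ (hN4 n n4).
  rewrite /E /good n0 n1 n2 n3/=.
  have [mNn PNn _] := hN n.
  rewrite measure_setD_null//.
  apply: le_trans (small_noise_ge sn0 lamp (meps n) (hNormal n) (hIndep n n0)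
    (sum_sqr_col_standardize (hCols n n0))).
  by rewrite lee_fin lerD2l lerN2.
split=> rate.
  have [M hM] := A3; have [K [E [mE [EQ PE]]]] := core bt M rate.
  exists K, E; split => //; split => // n w Ew; apply: (EQ n w Ew) => // n0 p0.
  exact: hM.
have [M hM] := A4; have [K [E [mE [EQ PE]]]] := core c M rate.
exists K, E; split => //; split => // n w Ew.
apply: ge_ereal_sup => _ [s s01 <-]; rewrite lee_fin.
apply: (EQ n w Ew) => // n0 p0.
have := hM n (pn n) n0 p0; rewrite -lee_fin EFinM; apply: le_trans.
rewrite lee_wpmul2l ?lee_fin ?powR_ge0//.
exact: (sup01_ge s01 (lexx _)).
Qed.
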